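(* Let $k \geq 2$, $\delta > 0$ and $n \geq \left( \frac{3}{\delta} \right)^{1000k}$. Then every $\delta$-cut-dense tournament $T$ on $n$ vertices with $\delta^0(T) \geq \frac{n}{4} - \frac{\delta n}{200}$ contains the $k$-th power of a Hamilton cycle.
   Context: A tournament is an orientation of a complete graph; $\delta^0(T)$ is the minimum over all vertices of their in- and out-degrees. For $X,Y\subseteq V(T)$, $\overrightarrow{e}(X,Y)$ denotes the number of edges of $T$ oriented from $X$ to $Y$. A balanced partition of $V(T)$ is a partition $(X,Y)$ with $||X|-|Y||\le 1$. $T$ is $\delta$-cut-dense if every balanced partition $(X,Y)$ of $V(T)$ satisfies $\overrightarrow{e}(X,Y) \geq \delta|X||Y|$. The $k$-th power of a directed cycle $v_0v_1\ldots v_{l}v_0$ is the directed graph on its vertices with edges $v_iv_{i+j}$ for all $i$ and $1\le j\le k$ (indices mod $l+1$); containing the $k$-th power of a Hamilton cycle means containing such a subgraph through all vertices. *)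

(* Defs.v *)
From mathcomp Require Import all_boot all_order all_algebra.
From mathcomp Require Import reals.

Set Implicit Arguments.
Unset Strict Implicit.
Unset Printing Implicit Defensive.

Import Order.TTheory GRing.Theory Num.Theory.
Local Open Scope ring_scope.

(* [T x y] is read as: there is an edge oriented from [x] to [y]. *)
Definition is_tournament (V : finType) (T : rel V) : Prop :=
  irreflexive T /\ (forall x y : V, x != y -> T x y (+) T y x).

Definition outdeg (V : finType) (T : rel V) (v : V) : nat :=
  #|[set w | T v w]|.

Definition indeg (V : finType) (T : rel V) (v : V) : nat :=
  #|[set w | T w v]|.

(* The index [#|V|] of the iterated minimum bounds every degree, so it only
   matters as the value of an empty minimum. *)
Definition min_semidegree (V : finType) (T : rel V) : nat :=
  \big[minn/#|V|]_(v : V) minn (outdeg T v) (indeg T v).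

Definition edges_between (V : finType) (T : rel V) (X Y : {set V}) : nat :=
  #|[set p : V * V | [&& p.1 \in X, p.2 \in Y & T p.1 p.2]]|.

Definition balanced_partition (V : finType) (X Y : {set V}) : Prop :=
  [/\ X :|: Y = [set: V], [disjoint X & Y]
    & (#|X| <= #|Y| + 1)%N && (#|Y| <= #|X| + 1)%N].

Definition cut_dense (R : realType) (delta : R) (V : finType) (T : rel V)
    : Prop :=
  forall X Y : {set V}, balanced_partition X Y ->
    delta * #|X|%:R * #|Y|%:R <= (edges_between T X Y)%:R.

(* The k-th power of the directed cycle 0, 1, ..., m - 1, 0. As a directed graph
   it has no loops: the clause [i != j] discards the pairs with [d] a multiple
   of [m], which exist only when [m <= k]. *)
Definition cycle_power (k m : nat) (i j : 'I_m) : Prop :=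
  i != j /\
  exists d : nat, [/\ (1 <= d)%N, (d <= k)%N & j = (i + d) %% m :> nat]%N.

Definition has_hamilton_cycle_power (k : nat) (V : finType) (T : rel V)
    : Prop :=
  exists v : 'I_#|V| -> V,
    bijective v /\ (forall i j, cycle_power k i j -> T (v i) (v j)).

(* Main.v *)
Require Import Defs.
From mathcomp Require Import all_boot all_order all_algebra.
From mathcomp Require Import reals.
From mathcomp Require Import zify ring lra.

(** If the vertex sets [X], [Y] are disjoint, of linear size and together
    cover almost all vertices, then many edges go from [X] to [Y]: otherwise the
    semidegree condition forces [|X|] and [|Y|] to be close to [n / 2], and cut
    density is violated.  Together with dependent random choice, which finds a
    transitive [k]-set with a large common neighbourhood, this links any two
    large sets by a short chain of transitive [k]-sets, each dominating the next;
    such a chain spans a [k]-th power of a path.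

    Linking is used twice.  First, pairs [S -> R] such that every vertex [v] fits
    between some of them ([S -> v -> R]) are linked into an absorbing chain, with
    many pairs for each [v].  Second, many short connectors are set aside, such
    that for all vertices [u], [v] there are many connectors whose first set is
    dominated by [u] and whose last set dominates [v].  Median orders then cover
    almost all remaining vertices by long chains with large sets of candidate
    endpoints; by pigeonhole two such chains are joined by some unused connector.
    This yields a cycle of [k]-sets, and the absorbing chain takes up the
    vertices left over. *)

Set Implicit Arguments.
Unset Strict Implicit.
Unset Printing Implicit Defensive.

Import Order.TTheory GRing.Theory Num.Theory.

(** * Dependent random choice *)

(** For fixed [k] the bound on [n] is polynomial in [1 / delta], and this shapes the bookkeeping.
    One use of dependent random choice costs a factor [(1 / delta) ^ O(k)], absorbed in [y], the
    integer part of the 70th root of [n]. Only boundedly many such factors may be multiplied,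
    although a link can need a number of blocks linear in [1 / delta].

    Absorbers and connectors are built in rounds. Each new piece serves a share [1 / y ^ O(1)] of
    the demands still open, and [log n] is [O(y)], so polynomially many pieces in [y] serve every
    vertex, or every pair of vertices. With at least as many rounds as uses, each use takes a fresh
    round, and no matching argument is needed.

    A connector is promised to pairs of vertices, not to pairs of blocks. The end blocks of a chain
    are therefore left open: candidate sets are reserved, and the blocks are picked inside them once
    a connector is known to serve many candidate pairs. *)

Section Tournament.
Variables (V : finType) (T : rel V).
Hypothesis hT : is_tournament T.

Lemma tour_irr x : T x x = false.
Proof. by have [/(_ x)] := hT. Qed.

Lemma tour_neg x y : x != y -> T y x = ~~ T x y.
Proof. by have [_ h] := hT => /h; case: (T x y); case: (T y x). Qed.

Lemma card_out_in (A : {set V}) x :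
  x \in A -> #|A| = (#|[set y in A | T x y]| + #|[set y in A | T y x]|).+1.
Proof.
move=> xA; rewrite (cardsD1 x) xA add1n; congr _.+1.
rewrite -cardsUI -[LHS]addn0; congr addn.
  apply: eq_card => y; rewrite !inE.
  case: (eqVneq y x) => [->|yx] /=; first by rewrite tour_irr andbF.
  rewrite (tour_neg (x := x) (y := y)) 1?eq_sym //.
  by case: (y \in A); case: (T x y).
apply/esym/eqP; rewrite cards_eq0; apply/eqP/setP => y; rewrite !inE.
case: (eqVneq y x) => [->|yx] /=; first by rewrite tour_irr !andbF.
rewrite (tour_neg (x := x) (y := y)) 1?eq_sym //.
by case: (y \in A); case: (T x y).
Qed.

(** A vertex splits the rest of [W] into out- and in-neighbours, one of which is large enough for
    the induction; the vertex goes in front of the tuple found there or behind it. *)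
Lemma ramsey k (W : {set V}) : 2 ^ k <= #|W| ->
  exists S, [/\ size S = k, pairwise T S & {subset S <= W}].
Proof.
elim: k W => [|k IH] W; first by exists [::].
move=> hW; have /card_gt0P[x xW] : 0 < #|W| by rewrite (leq_trans _ hW) ?expn_gt0.
have hc := card_out_in xW; rewrite expnS in hW.
have [/IH|h] := leqP (2 ^ k) #|[set y in W | T x y]|.
  case=> S [sS pS iS]; exists (x :: S); split; rewrite ?pairwise_cons ?pS ?andbT /= ?sS //.
    by apply/allP => y /iS; rewrite inE => /andP[].
  by move=> y; rewrite inE => /predU1P[->//|/iS]; rewrite inE => /andP[].
have /IH : 2 ^ k <= #|[set y in W | T y x]| by lia.
case=> S [sS pS iS]; exists (rcons S x); split; rewrite ?size_rcons ?sS //.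
  rewrite pairwise_rcons pS andbT; apply/allP => y /iS.
  by rewrite inE => /andP[].
by move=> y; rewrite mem_rcons inE => /predU1P[->//|/iS]; rewrite inE => /andP[].
Qed.

Lemma card_ffun_set (X Y : finType) (B : {set Y}) :
  #|[set f : {ffun X -> Y} | [forall i, f i \in B]]| = #|B| ^ #|X|.
Proof.
rewrite -card_ffun_on; apply: eq_card => f; rewrite inE.
by apply/forallP/ffun_onP.
Qed.

(* For every [k]-tuple [f] of targets let [W f] be the set of sources adjacent
   to all of [f]; if every transitive [k]-tuple had few common targets, then on
   average [W f] would be too small. *)
Lemma dependent_random_choice k b (Y : finType) (r : V -> Y -> bool)
    (A : {set V}) (B : {set Y}) :
  2 <= k -> 0 < b -> 0 < #|B| -> 2 ^ k.+1 * b ^ k <= #|A| ->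
  (forall x, x \in A -> #|B| <= b * #|[set z in B | r x z]|) ->
  exists S, [/\ size S = k, pairwise T S, {subset S <= A} &
    #|B| <= 2 * (2 ^ k.+1 * b ^ k) * b * #|[set z in B | all (r^~ z) S]|].
Proof.
move=> k2 b0 B0; set m := 2 ^ k.+1 * b ^ k => hA hdeg.
have [A' sA cA'] : exists2 A' : {set V}, A' \subset A & #|A'| = m.
  have /card_gt0P[A'] : 0 < #|[set A' : {set V} | (A' \subset A) && (#|A'| == m)]|.
    by rewrite cards_draws bin_gt0.
  by rewrite inE => /andP[? /eqP ?]; exists A'.
pose P := 2 * m * b.
pose C (S : seq V) := [set z in B | all (r^~ z) S].
pose G := [set g : {ffun 'I_k -> V} | [forall i, g i \in A']].
pose good (g : {ffun 'I_k -> V}) := (g \in G) && pairwise T (codom g).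
have [|hex] := boolP [exists g, good g && (#|B| <= P * #|C (codom g)|)].
  case/existsP => g /andP[/andP[gG pg] hB]; exists (codom g); split => //.
  - by rewrite size_codom card_ord.
  - move=> x /codomP[i ->]; apply: (subsetP sA).
    by move: gG; rewrite inE => /forallP.
have hbad g : good g -> P * #|C (codom g)| < #|B|.
  move=> hg; move/existsPn: hex => /(_ g); rewrite hg /= => h; lia.
exfalso.
pose F := [set f : {ffun 'I_k -> Y} | [forall i, f i \in B]].
pose W (f : {ffun 'I_k -> Y}) := [set x in A' | [forall i, r x (f i)]].
have cF : #|F| = #|B| ^ k.
  by rewrite card_ffun_set card_ord.
have cG : #|G| = m ^ k.
  by rewrite card_ffun_set card_ord cA'.
(* A crude count is enough: beyond [2 ^ k] elements Ramsey gives one good tuple inside [W f], and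
   that tuple alone pays for the trivial bound [m]. *)
have hW f : #|W f| <= 2 ^ k + m * #|[set g | good g & [forall i, g i \in W f]]|.
  have WA : #|W f| <= m.
    by rewrite -cA'; apply/subset_leq_card/subsetP => x; rewrite inE => /andP[].
  have [|/ltnW/ramsey[S [sS pS iS]]] := leqP #|W f| (2 ^ k).
    by move=> h; rewrite (leq_trans h) // leq_addr.
  have h : 0 < #|[set g | good g & [forall i, g i \in W f]]|.
    have sS' : size S == k by rewrite sS.
    apply/card_gt0P; exists [ffun i => tnth (Tuple sS') i].
    rewrite inE; apply/andP; split.
      rewrite /good codomE (eq_map (ffunE _)) map_tnth_enum /= pS andbT inE.
      apply/forallP => i; rewrite ffunE.
      by have /iS := mem_tnth i (Tuple sS'); rewrite inE => /andP[].
    by apply/forallP => i; rewrite ffunE (iS _ (mem_tnth i (Tuple sS'))).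
  rewrite (leq_trans WA) // (leq_trans _ (leq_addl _ _)) //.
  by rewrite -[leqLHS]muln1 leq_mul.
have sW : \sum_(f in F) #|W f| = \sum_(x in A') #|[set z in B | r x z]| ^ k.
  transitivity (\sum_(f in F) \sum_(x in A' | [forall i, r x (f i)]) 1).
    by apply: eq_bigr => f _; rewrite -sum1_card; apply: eq_bigl => x; rewrite inE.
  rewrite (exchange_big_dep (mem A')) /=; last by move=> f x _ /andP[].
  apply: eq_bigr => x xA; rewrite -[k in RHS]card_ord -card_ffun_set -sum1_card.
  apply: eq_bigl => f; rewrite !inE xA /=; apply/andP/forallP.
    by case=> /forallP fB /forallP fx i; rewrite inE fB fx.
  by move=> h; split; apply/forallP => i; have := h i; rewrite inE => /andP[].
have sG : \sum_(f in F) #|[set g | good g & [forall i, g i \in W f]]|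
    = \sum_(g | good g) #|C (codom g)| ^ k.
  transitivity (\sum_(f in F) \sum_(g | good g && [forall i, g i \in W f]) 1).
    by apply: eq_bigr => f _; rewrite -sum1_card; apply: eq_bigl => x; rewrite inE.
  rewrite (exchange_big_dep good) /=; last by move=> f x _ /andP[].
  apply: eq_bigr => g gg; rewrite -[X in _ ^ X]card_ord -card_ffun_set -sum1_card.
  apply: eq_bigl => f; rewrite !inE gg /=; apply/andP/forallP.
    case=> /forallP fB /forallP gW i; rewrite inE fB; apply/allP => x /codomP[j ->].
    by have := gW j; rewrite inE => /andP[_ /forallP].
  move=> h; split; apply/forallP => i.
    by have := h i; rewrite inE => /andP[].
  have /forallP gA : [forall i, g i \in A'].
    by case/andP: (gg); rewrite inE.
  rewrite inE gA /=.
  apply/forallP => j; have := h j; rewrite inE => /andP[_ /allP]; apply.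
  exact: codom_f.
have h1 : m * #|B| ^ k <= b ^ k * \sum_(f in F) #|W f|.
  rewrite sW big_distrr /= -cA' -sum_nat_const.
  by apply: leq_sum => x xA; rewrite -expnMn leq_exp2r ?hdeg ?(subsetP sA) //; lia.
have h2 : P ^ k * \sum_(g | good g) #|C (codom g)| ^ k <= m ^ k * #|B| ^ k.
  rewrite big_distrr /= -cG -sum_nat_const (bigID (mem G)) /= [X in _ + X]big1 ?addn0.
    rewrite [leqRHS]big_mkcond [leqLHS]big_mkcond /=.
    apply: leq_sum => g _; case: ifP => // /andP[gg ->].
    by rewrite -expnMn leq_exp2r; [exact/ltnW/hbad|lia].
  by move=> g /andP[/andP[gG _] /negP]; case.
have h3 : \sum_(f in F) #|W f| <= #|B| ^ k * 2 ^ k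
    + m * \sum_(g | good g) #|C (codom g)| ^ k.
  rewrite -sG big_distrr /= -cF -sum_nat_const -big_split /=.
  by apply: leq_sum => f _.
have {}h3 : P ^ k * (m * #|B| ^ k) <=
    b ^ k * (P ^ k * (#|B| ^ k * 2 ^ k) + m * (m ^ k * #|B| ^ k)).
  rewrite (leq_trans (leq_mul (leqnn _) h1)) // mulnCA leq_mul //.
  rewrite (leq_trans (leq_mul (leqnn _) h3)) // mulnDr leq_add //.
  by rewrite mulnCA leq_mul.
have {}h3 : P ^ k * m <= b ^ k * (P ^ k * 2 ^ k + m * m ^ k).
  rewrite -(leq_pmul2r (m := #|B| ^ k)) ?expn_gt0 ?B0 //.
  by move: h3; congr (_ <= _); ring.
have m0 : 0 < m by rewrite muln_gt0 !expn_gt0 b0.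
have hK : 4 <= 2 ^ k by rewrite -[4]/(2 ^ 2) leq_exp2l.
have M0 : 0 < m ^ k by rewrite expn_gt0 m0.
have b0' : 0 < b ^ k by rewrite expn_gt0 b0.
have hm : m = 2 * 2 ^ k * b ^ k by rewrite /m expnS.
move: h3; rewrite /P -/m; clearbody m; rewrite !expnMn leqNgt.
move/negP; apply.
rewrite {2 5}hm.
(* On average [W f] has at least [m / b ^ k = 2 * K] elements, twice the Ramsey threshold [K], while
   the good tuples contribute at most 2. So [K + K <= K + 2] would follow, against [4 <= K]. *)
set K := 2 ^ k; set M := m ^ k; set c := b ^ k.
have -> : K * M * c * (2 * K * c) = K * M * c * c * (K + K) by ring.
have -> : c * (K * M * c * K + 2 * K * c * M) = K * M * c * c * (K + 2) by ring.
by rewrite ltn_pmul2l ?muln_gt0 ?M0 ?b0' ?andbT /=; lia.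
Qed.

End Tournament.

(** * Expansion from cut density *)

Lemma sum_le_heavy (I : finType) (A : {set I}) (f : I -> nat) M t :
  (forall x, x \in A -> f x <= M) ->
  \sum_(x in A) f x <= #|[set x in A | t <= f x]| * M + #|A| * t.
Proof.
move=> hM; rewrite (bigID (fun x => t <= f x)) /= leq_add //.
  rewrite -sum_nat_const [leqRHS]big_mkcond [leqLHS]big_mkcond /=.
  apply: leq_sum => x _; rewrite inE; case: ifP => // /andP[xA _]; exact: hM.
rewrite -sum_nat_const [leqRHS]big_mkcond [leqLHS]big_mkcond /=.
apply: leq_sum => x _; case: ifP => // /andP[-> ]; rewrite -ltnNge; exact: ltnW.
Qed.

Lemma sum_card_rel (I J : finType) (A : {set I}) (B : {set J}) (r : I -> J -> bool) :
  \sum_(x in A) #|[set z in B | r x z]| = \sum_(z in B) #|[set x in A | r x z]|.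
Proof.
transitivity (\sum_(x in A) \sum_(z in B | r x z) 1).
  by apply: eq_bigr => x _; rewrite -sum1_card; apply: eq_bigl => z; rewrite inE.
rewrite (exchange_big_dep (mem B)) /=; last by move=> x z _ /andP[].
by apply: eq_bigr => z zB; rewrite -sum1_card; apply: eq_bigl => x; rewrite inE zB.
Qed.

Lemma edges_between_sum (V : finType) (T : rel V) (X Y : {set V}) :
  edges_between T X Y = \sum_(x in X) #|[set y in Y | T x y]|.
Proof.
transitivity (\sum_(x in X) \sum_(y in Y | T x y) 1).
  rewrite pair_big_dep /= sum1_card; apply: eq_card => p; rewrite !inE.
  by rewrite unfold_in.
by apply: eq_bigr => x _; rewrite -sum1_card; apply: eq_bigl => z; rewrite inE.
Qed.

Lemma is_tournament_tr (V : finType) (T : rel V) :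
  is_tournament T -> is_tournament (fun x y => T y x).
Proof. by move=> [h1 h2]; split=> // x y xy; apply: h2; rewrite eq_sym. Qed.

(** Here [a] and [b] count the vertices added to the two sides of a sparse pair to balance it. Both
    are about [62 * n / (1000 * d)] at most, so at most about 64 thousandths of [n ^ 2 / d] edges
    cross, whereas cut density demands about a quarter. *)
Lemma dense_cut_arith n d h cX a b x y e e' :
  2 <= d -> 1000 * d <= n -> h + h <= n <= h + h + 1 -> cX + h = n ->
  a <= n - h - x -> b <= h - y ->
  500 * d * n <= 1000 * d * x + 62 * n -> 500 * d * n <= 1000 * d * y + 62 * n ->
  500 * d * e <= n * n -> e' <= e + a * h + cX * b -> cX * h <= d * e' -> False.
Proof.
move=> d2 hn hh hc hXX hYY hX hY he he' hc1.
have ha : 1000 * d * a <= 62 * n + 500 * d.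
  have [->|ha] : a = 0 \/ a + h + x <= n by lia.
    by rewrite muln0.
  have : d * (a + h + x) <= d * n by rewrite leq_mul2l ha orbT.
  have : d * n <= d * (h + h + 1) by rewrite leq_mul2l; lia.
  lia.
have hb : 1000 * d * b <= 62 * n.
  have [->|hb] : b = 0 \/ b + y <= h by lia.
    by rewrite muln0.
  have : d * (b + y) <= d * h by rewrite leq_mul2l hb orbT.
  have : d * (h + h) <= d * n by rewrite leq_mul2l; lia.
  lia.
have h0 : d * e' <= d * (e + a * h + cX * b) by rewrite leq_mul2l he' orbT.
have h2 : (1000 * d * a) * h <= (62 * n + 500 * d) * h by rewrite leq_mul2r ha orbT.
have h3 : cX * (1000 * d * b) <= cX * (62 * n) by rewrite leq_mul2l hb orbT.
have h4 : 1000 * (cX * h) <= 2 * (n * n) + 62 * n * (cX + h) + 500 * d * h by lia.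
have h5 : 1000 * d * h <= n * h by rewrite leq_mul2r hn orbT.
have h6 : h * h <= cX * h by rewrite leq_mul2r; lia.
have h7 : cX * cX <= cX * (h + 1) by rewrite leq_mul2l; lia.
have h8 : cX * 2 <= cX * h by rewrite leq_mul2l; lia.
move: h4 h5; rewrite -hc; lia.
Qed.

Section Sparse.
Variables (V : finType) (T : rel V).
Hypothesis hT : is_tournament T.

Lemma sum_inside (Y : {set V}) :
  2 * (\sum_(y in Y) #|[set x in Y | T x y]|) <= #|Y| * #|Y|.
Proof.
rewrite mul2n -addnn -{1}sum_card_rel -big_split /= -sum_nat_const.
by apply: leq_sum => x xY; rewrite (card_out_in hT xY) ltnW.
Qed.

(** Average the in-degrees over [Y]: at most [|Y| / 2] comes from inside. The edges from [X], the
    uncovered vertices and the slack in the degree condition cost 20, 1 and 10 thousandths of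
    [n / d]; twice their sum is the 62. *)
Lemma sparse_cut_large n d (X Y : {set V}) :
  2 <= d -> n = #|V| -> [disjoint X & Y] -> 1000 * d * #|~: (X :|: Y)| <= n ->
  n <= 10 * #|Y| ->
  (forall v, 25 * d * n <= 100 * d * #|[set w | T w v]| + n) ->
  500 * d * \sum_(x in X) #|[set y in Y | T x y]| <= n * n ->
  500 * d * n <= 1000 * d * #|Y| + 62 * n.
Proof.
move=> d2 en dXY; set u := #|_|; set e := \sum_(_ in _) _ => hu nY hdeg he.
have h1 : #|Y| * (25 * d * n) <=
    100 * d * (e + \sum_(y in Y) #|[set x in Y | T x y]| + #|Y| * u) + #|Y| * n.
  rewrite /e sum_card_rel -sum_nat_const -[#|Y| * u]sum_nat_const -[#|Y| * n]sum_nat_const.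
  rewrite -!big_split big_distrr -big_split /=; apply: leq_sum => v _.
  rewrite (leq_trans (hdeg v)) // leq_add2r leq_mul2l; apply/orP; right.
  rewrite -(setID [set w | T w v] (X :|: Y)) (leq_trans (leq_card_setU _ _)) // leq_add //.
    rewrite setIUr (leq_trans (leq_card_setU _ _)) // leq_add //; apply/subset_leq_card/subsetP=> w;
    by rewrite !inE => /andP[-> ->].
  by apply/subset_leq_card/subsetP=> w; rewrite !inE => /andP[->].
have h2 := sum_inside Y.
have Y0 : 0 < #|Y| \/ n = 0 by lia.
case: Y0 => [Y0|->]; last by rewrite !muln0.
rewrite -(leq_pmul2l Y0) -(leq_pmul2l (m := 10)) //.
move: h1 h2 hu nY he Y0; clear; move: (\sum_(y in Y) _) (#|Y|) => s b; clearbody e u.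
move: b => {}Y.
move=> h1 h2 hu nY he Y0.
have a1 : n * n <= 10 * Y * n by rewrite leq_mul2r nY orbT.
have a2 : Y * (1000 * d * u) <= Y * n by rewrite leq_mul2l hu orbT.
have a3 : d * (2 * s) <= d * (Y * Y) by rewrite leq_mul2l h2 orbT.
nia.
Qed.

End Sparse.

Lemma subset_between (V : finType) (A B : {set V}) h :
  A \subset B -> #|A| <= h <= #|B| ->
  exists C : {set V}, [/\ A \subset C, C \subset B & #|C| = h].
Proof.
move=> sAB /andP[hA hB].
have /card_gt0P[C] : 0 < #|[set C : {set V} | (C \subset B :\: A) && (#|C| == h - #|A|)]|.
  by rewrite cards_draws bin_gt0 cardsDS // leq_sub2r.
rewrite inE subsetD => /andP[/andP[CB dCA] /eqP hC]; exists (A :|: C); split.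
- exact: subsetUl.
- by rewrite subUset sAB.
- by rewrite cardsU disjoint_setI0 1?disjoint_sym // cards0 subn0 hC subnKC.
Qed.

Section Expansion.
Variables (V : finType) (T : rel V) (n d : nat).
Hypothesis hT : is_tournament T.
Hypothesis n_card : n = #|V|.
Hypothesis d2 : 2 <= d.
Hypothesis hn : 1000 * d <= n.
Hypothesis hout : forall v, 25 * d * n <= 100 * d * #|[set w | T v w]| + n.
Hypothesis hin : forall v, 25 * d * n <= 100 * d * #|[set w | T w v]| + n.
Hypothesis hcut : forall X Y : {set V}, balanced_partition X Y ->
  #|X| * #|Y| <= d * edges_between T X Y.

Lemma edges_between_enlarge (X Y X' Y' : {set V}) :
  edges_between T X' Y' <=
    edges_between T X Y + #|X' :\: X| * #|Y'| + #|X'| * #|Y' :\: Y|.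
Proof.
rewrite !edges_between_sum (big_setID X) /= addnAC; apply: leq_add; last first.
  by rewrite -sum_nat_const leq_sum // => x _; apply/subset_leq_card/subsetP => y; rewrite inE => /andP[].
have -> : \sum_(x in X) #|[set y in Y | T x y]| =
   \sum_(x in X' :&: X) #|[set y in Y | T x y]| + \sum_(x in X :\: X') #|[set y in Y | T x y]|.
  by rewrite (big_setID X') setIC.
apply: (leq_trans (n := \sum_(x in X' :&: X) (#|[set y in Y | T x y]| + #|Y' :\: Y|))).
  apply: leq_sum => x _; rewrite -(setID [set y in Y' | T x y] Y).
  rewrite (leq_trans (leq_card_setU _ _)) // leq_add //; apply/subset_leq_card/subsetP=> y.
    by rewrite !inE => /andP[/andP[_ ->] ->].
  by rewrite !inE => /andP[-> /andP[-> _]].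
rewrite big_split /= sum_nat_const leq_add ?leq_addr //.
by rewrite leq_mul2r subset_leq_card ?orbT // subsetIl.
Qed.

Lemma dense_cut (X Y : {set V}) :
  [disjoint X & Y] -> 1000 * d * #|~: (X :|: Y)| <= n ->
  n <= 10 * #|X| -> n <= 10 * #|Y| -> n * n < 500 * d * edges_between T X Y.
Proof.
move=> dXY hU nX nY; rewrite ltnNge; apply/negP => he.
have hY : 500 * d * n <= 1000 * d * #|Y| + 62 * n.
  by apply: (sparse_cut_large hT d2 n_card dXY) => //; rewrite -edges_between_sum.
have hX : 500 * d * n <= 1000 * d * #|X| + 62 * n.
  apply: (sparse_cut_large (is_tournament_tr hT) d2 n_card (X := Y) (Y := X)) => //.
  - by rewrite disjoint_sym.
  - by rewrite setUC.
  - by rewrite -sum_card_rel -edges_between_sum.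
pose h := n./2.
have hh : h + h <= n <= h + h + 1 by rewrite /h; have := odd_double_half n; case: (odd n); lia.
have cC (A : {set V}) : #|~: A| + #|A| = n by rewrite addnC cardsC n_card.
(* [Y'] is taken comparable with [Y] and with the complement of [X], so that each side gains as few
   vertices as possible. The subtractions are truncated: a side that need not grow gains nothing. *)
have [Y' [cY' hXX hYY]] : exists Y' : {set V},
    [/\ #|Y'| = h, #|~: Y' :\: X| <= n - h - #|X| & #|Y' :\: Y| <= h - #|Y|].
  have [hY'|hY'] := leqP h #|Y|.
    have [|Y' [_ sY' cY']] := @subset_between _ set0 Y h (sub0set _); first by rewrite cards0.
    exists Y'; split=> //; last by rewrite (_ : _ :\: _ = set0) ?cards0 //; apply/eqP; rewrite setD_eq0.
    rewrite cardsDS; first by rewrite -(cC Y') cY' addnK.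
    by rewrite -disjoints_subset (disjointWr sY').
  have sY : Y \subset ~: X by rewrite -disjoints_subset disjoint_sym.
  have [hX'|hX'] := leqP h #|~: X|.
    have [|Y' [sY' sX' cY']] := @subset_between _ Y (~: X) h sY; first by rewrite ltnW.
    exists Y'; split=> //; last by rewrite cardsDS // cY'.
    by rewrite cardsDS 1?subsetC // -(cC Y') cY' addnK.
  have [|Y' [sY' _ cY']] := @subset_between _ (~: X) setT h (subsetT _).
    by rewrite (ltnW hX') cardsT -n_card; lia.
  exists Y'; split=> //.
    by rewrite (_ : _ :\: _ = set0) ?cards0 //; apply/eqP; rewrite setD_eq0 subCset.
  by rewrite cardsDS ?cY' // (subset_trans sY).
have hb : balanced_partition (~: Y') Y'.
  split; first by rewrite setUC setUCr.
    by rewrite disjoint_sym disjoints_subset setCK.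
  by have := cC Y'; rewrite cY'; lia.
have := edges_between_enlarge X Y (~: Y') Y'; rewrite cY' => he'.
apply: (dense_cut_arith d2 hn hh _ hXX hYY hX hY he he').
  by rewrite -(cC Y') cY'.
by have := hcut hb; rewrite cY'.
Qed.

(** Vertices below the degree threshold carry at most half of the edges given by [dense_cut]; this
    is the factor 2 between 500 and 1000. *)
Lemma expansion (X Y : {set V}) :
  [disjoint X & Y] -> 1000 * d * #|~: (X :|: Y)| <= n ->
  n <= 10 * #|X| -> n <= 10 * #|Y| ->
  n <= 1000 * d * #|[set x in X | n <= 1000 * d * #|[set y in Y | T x y]|]|.
Proof.
move=> dXY hU nX nY; have := dense_cut dXY hU nX nY.
have cX (A : {set V}) : #|A| <= n by rewrite n_card max_card.
rewrite edges_between_sum; set e := \sum_(x in X) _.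
have : 1000 * d = 2 * (500 * d) by rewrite mulnA.
move: (1000 * d) (500 * d) => c c' hc h2.
have := @sum_le_heavy _ X (fun x => c * #|[set y in Y | T x y]|) (c * n) n.
rewrite -big_distrr /= -/e.
set H := #|[set _ in X | _]| => /(_ (fun x _ => leq_mul (leqnn _) (cX _))) h1.
rewrite leqNgt; apply/negP => h3.
have h4 : #|X| * n <= n * n by rewrite leq_mul2r cX orbT.
have h5 : (c * H) * n <= n * n by rewrite leq_mul2r (ltnW h3) orbT.
lia.
Qed.

End Expansion.

(** * Chains of transitive blocks *)

Section Blocks.
Variables (V : finType) (T : rel V) (k : nat).

Definition block (B : seq V) := (k == size B) && pairwise T B.

(* A vertex [v] inserted between [B] and [C] is appended to [B]; only the first
   [k] vertices of a block matter for what comes before it. *)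
Definition precedes (B C : seq V) := allrel T B (take k C).

Definition chain (q : seq (seq V)) :=
  [&& all block q, sorted precedes q & uniq (flatten q)].

Lemma allrel_precedes (B C : seq V) : allrel T B C -> precedes B C.
Proof. by move=> /allrelP h; apply/allrelP => x z xB /mem_take; apply: h. Qed.

Lemma chain1 S : irreflexive T -> block S -> chain [:: S].
Proof.
move=> irr bS; rewrite /chain /= bS cats0; apply: (pairwise_uniq irr).
by case/andP: bS.
Qed.

Lemma chain_cat q1 q2 : chain q1 -> chain q2 ->
  (forall B C, q1 != [::] -> q2 != [::] -> precedes (last B q1) (head C q2)) ->
  ~~ has (mem (flatten q1)) (flatten q2) -> chain (q1 ++ q2).
Proof.
case/and3P=> a1 s1 u1 /and3P[a2 s2 u2] h dis.
rewrite /chain all_cat a1 a2 flatten_cat cat_uniq u1 u2 dis !andbT /=.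
case: q1 s1 h {a1 u1 dis} => //= B q1 s1; case: q2 s2 {a2 u2} => [|C q2] s2 h.
  by rewrite cats0.
by rewrite cat_path s1 /=; move: s2 => /= ->; rewrite andbT; have := h B C isT isT.
Qed.

Lemma size_flatten_chain q : chain q -> size (flatten q) = size q * k.
Proof.
case/and3P => + _ _; elim: q => //= B q IH /andP[/andP[/eqP h _] /IH hq].
by rewrite size_cat hq -h mulSn.
Qed.

Definition serves (e : seq (seq V)) v := exists e1 S R e2,
  [/\ e = e1 ++ S :: R :: e2, all (T^~ v) S & all (T v) R].

Lemma serves_catl e e' v : serves e v -> serves (e ++ e') v.
Proof.
by case=> e1 [S [R [e2 [-> h1 h2]]]]; exists e1, S, R, (e2 ++ e'); rewrite -catA.
Qed.

Lemma serves_catr e e' v : serves e' v -> serves (e ++ e') v.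
Proof.
by case=> e1 [S [R [e2 [-> h1 h2]]]]; exists (e ++ e1), S, R, e2; rewrite -catA.
Qed.

Definition oc_vertices (p : seq V * seq V * seq (seq V) * seq V) :=
  let: (Am, R, q, Ap) := p in Am ++ flatten (R :: q) ++ Ap.

Definition oc_blocks (p : seq V * seq V * seq (seq V) * seq V) :=
  let: (Am, R, q, Ap) := p in R :: q.

(** [Am] and [Ap] are reserves for a later end block, not parts of the chain: at most [k] vertices
    of each are ever used. Counting them in [oc_vertices] keeps the reserves of different chains
    disjoint. *)
Definition open_chain a (p : seq V * seq V * seq (seq V) * seq V) :=
  let: (Am, R, q, Ap) := p in
  [/\ chain (R :: q), allrel T Am R, allrel T (last R q) Ap,
      size Am = a /\ size Ap = a & uniq (oc_vertices p)].

End Blocks.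

(* [E] is the inverse of the expansion constant, and [y] a power of it which
   dominates every loss in dependent random choice; all other quantities are
   fixed powers of [y]. *)
Lemma card_le_sum_cover (J : eqType) (K : finType) (X : {set K}) (cs : seq J)
    (P : J -> K -> bool) :
  {in X, forall p, has (P^~ p) cs} -> #|X| <= \sum_(q <- cs) #|[set p in X | P q p]|.
Proof.
elim: cs X => [|q cs IH] X hX.
  by rewrite big_nil leqn0 cards_eq0; apply/eqP/setP => p; rewrite inE; apply/negP => /hX.
rewrite big_cons -(cardsID [set p | P q p] X); apply: leq_add.
  by apply/subset_leq_card/subsetP => p; rewrite !inE.
apply: leq_trans (IH _ _) _ => [p|].
  by rewrite !inE => /andP[/negbTE h /hX]; rewrite /= h.
apply: leq_sum => r _; apply/subset_leq_card/subsetP => p; rewrite !inE.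
by case/andP=> /andP[_ ->] ->.
Qed.

(** * Geometric decay without logarithms *)

Lemma two_mul_pred_exp P : 0 < P -> 2 * P.-1 ^ P <= P ^ P.
Proof.
case: P => // q _; rewrite succnK; case: (posnP q) => [->|q0]; first by rewrite expn1.
(* Bernoulli's inequality [1 + j / q <= (1 + 1 / q) ^ j] without denominators, used below for
   [j = q + 1]. *)
have h j : q ^ j * (q + j) <= q * q.+1 ^ j.
  elim: j => [|j IH]; first by rewrite !expn0 muln1 mul1n addn0.
  rewrite !expnS (mulnCA q q.+1) (leq_trans _ (leq_mul (leqnn q.+1) IH)) //.
  rewrite mulnAC [q.+1 * _]mulnCA mulnC leq_mul //; nia.
rewrite -(leq_pmul2l q0) (leq_trans _ (h q.+1)) // mulnCA mulnA mulnC leq_mul //.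
by lia.
Qed.

Lemma decay_lt P L m : 0 < P -> m < 2 ^ L -> m * P.-1 ^ (P * L) < P ^ (P * L).
Proof.
move=> P0 hm; rewrite !expnM.
have h := two_mul_pred_exp P0.
have : 2 ^ L * (P.-1 ^ P) ^ L <= (P ^ P) ^ L.
  by case: L {hm} => // L; rewrite -expnMn leq_exp2r.
have [->|h0] := posnP ((P.-1 ^ P) ^ L); first by rewrite !muln0 !expn_gt0 P0.
by apply: leq_trans; rewrite ltn_pmul2r.
Qed.

(** The invariant of the greedy constructions: [a * P.-1 ^ N < P ^ N] says that [N] steps, each
    serving a share [1 / P] of the open demands, exhaust [a] demands. [decay_lt] provides its
    initial value. *)
Lemma decay_step P N a b c :
  a * P.-1 ^ N.+1 < P ^ N.+1 -> a = b + c -> a <= P * b -> 0 < P -> c * P.-1 ^ N < P ^ N.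
Proof.
case: P => // q; rewrite succnK => h1 h2 h3 _.
rewrite -(ltn_pmul2l (m := q.+1)) // -expnS (leq_ltn_trans _ h1) // expnS !mulnA.
by rewrite leq_mul2r; apply/orP; right; lia.
Qed.

(** * Median orders *)

Section Median.
Variables (V : finType) (T : rel V).
Hypothesis hT : is_tournament T.

Fixpoint forward_edges (s : seq V) :=
  if s is x :: s' then count (T x) s' + forward_edges s' else 0.

Lemma forward_edges_cat s1 s2 : forward_edges (s1 ++ s2) =
  forward_edges s1 + \sum_(x <- s1) count (T x) s2 + forward_edges s2.
Proof.
elim: s1 => [|x s1 IH] /=; first by rewrite big_nil.
by rewrite IH big_cons count_cat; lia.
Qed.

(** The interval property of median orders, kept in place of the maximality of [forward_edges] from
    which it follows. *)
Definition median (w : seq V) :=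
  (forall w1 x w2 w3, w = w1 ++ x :: w2 ++ w3 -> size w2 <= 2 * count (T x) w2) /\
  (forall w1 x w2 w3, w = w1 ++ w2 ++ x :: w3 -> size w2 <= 2 * count (T^~ x) w2).

Lemma count_out_in x s : x \notin s -> count (T x) s + count (T^~ x) s = size s.
Proof.
move=> xs; rewrite -(count_predC (T x) s); congr addn; apply: eq_in_count => z zs /=.
by rewrite (tour_neg hT) //; apply: contraNneq xs => ->.
Qed.

Lemma sum_count_cons x w3 w2 : \sum_(y <- w2) count (T y) (x :: w3) =
  count (T^~ x) w2 + \sum_(y <- w2) count (T y) w3.
Proof.
by elim: w2 => [|y w2 IH]; rewrite ?big_nil // !big_cons IH /=; case: (T y x); lia.
Qed.

Lemma seq_argmax (I : eqType) (f : I -> nat) x0 (s : seq I) : exists2 x,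
  x \in x0 :: s & forall z, z \in x0 :: s -> f z <= f x.
Proof.
elim: s x0 => [|x1 s IH] x0; first by exists x0; rewrite ?inE // => z; rewrite inE => /eqP->.
have [x xs hx] := IH x1; have [h|h] := leqP (f x0) (f x).
  by exists x; rewrite 1?inE ?xs ?orbT // => z; rewrite inE => /predU1P[->|/hx].
exists x0; rewrite ?mem_head // => z; rewrite inE => /predU1P[->//|/hx hz].
exact: leq_trans hz (ltnW h).
Qed.

(** In an order with the most forward edges, moving [x] across an adjacent interval [w2] changes
    only the pairs formed by [x] and [w2]; hence at least half of these are already forward. *)
Lemma median_order s : uniq s -> exists2 w, perm_eq w s & median w.
Proof.
move=> us; have sP : s \in permutations s by rewrite mem_permutations.
case e : (permutations s) sP => [//|w0 ws] _.
have [w] := seq_argmax forward_edges w0 ws; rewrite -e mem_permutations => pw hw.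
have hw' z : perm_eq z s -> forward_edges z <= forward_edges w.
  by rewrite -mem_permutations; apply: hw.
have uw : uniq w by rewrite (perm_uniq pw).
exists w => //; split=> w1 x w2 w3 ew.
- have pz : perm_eq (w1 ++ w2 ++ x :: w3) s.
    apply: perm_trans pw; rewrite ew perm_cat2l; exact/permPl/(perm_catCA w2 [:: x] w3).
  have := hw' _ pz; rewrite ew !forward_edges_cat /= !forward_edges_cat /= !count_cat.
  have xw2 : x \notin w2.
    by move: uw; rewrite ew cat_uniq /= => /and3P[_ _ /andP[+ _]]; rewrite mem_cat negb_or => /andP[].
  have := count_out_in xw2.
  rewrite (sum_count_cons x w3 w2).
  have -> : \sum_(y <- w1) count (T y) (x :: w2 ++ w3) = \sum_(y <- w1) count (T y) (w2 ++ x :: w3).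
    by apply: eq_bigr => y _; rewrite /= !count_cat /= addnCA.
  move: (\sum_(_ <- w1) _) (\sum_(_ <- w2) _) => a b.
  move: (forward_edges _) (forward_edges _) (forward_edges _) (count _ _) (count _ _) (count _ _) (size _).
  by clear; lia.
- have pz : perm_eq (w1 ++ x :: w2 ++ w3) s.
    apply: perm_trans pw; rewrite ew perm_cat2l; exact/permPl/(perm_catCA [:: x] w2 w3).
  have := hw' _ pz; rewrite ew !forward_edges_cat /= !forward_edges_cat /= !count_cat.
  have xw2 : x \notin w2.
    move: uw; rewrite ew !cat_uniq => /and3P[_ _ /and3P[_ + _]].
    by rewrite /= negb_or => /andP[].
  have := count_out_in xw2.
  rewrite (sum_count_cons x w3 w2).
  have -> : \sum_(y <- w1) count (T y) (x :: w2 ++ w3) = \sum_(y <- w1) count (T y) (w2 ++ x :: w3).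
    by apply: eq_bigr => y _; rewrite /= !count_cat /= addnCA.
  move: (\sum_(_ <- w1) _) (\sum_(_ <- w2) _) => a b.
  move: (forward_edges _) (forward_edges _) (forward_edges _) (count _ _) (count _ _) (count _ _) (size _).
  by clear; lia.
Qed.

Lemma card_count (D : seq V) (P : pred V) : uniq D -> #|[set z in [set z in D] | P z]| = count P D.
Proof.
move=> uD; rewrite -size_filter -(card_uniqP (filter_uniq P uD)).
by apply: eq_card => z; rewrite !inE mem_filter andbC.
Qed.

(** [x] dominates half of the interval running from its successor to the end of [D]. The part of it
    inside [c] is at most half as long as [D], so even if dominated entirely it leaves a quarter of
    [D]. *)
Lemma median_out w0 c D w3 x : median (w0 ++ c ++ D ++ w3) ->
  x \in c -> 2 * size c <= size D -> size D <= 4 * count (T x) D.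
Proof.
move=> + xc; case/path.splitPr: xc => c1 c2 [h _]; rewrite size_cat /= => hs.
have := h (w0 ++ c1) x (c2 ++ D) w3; rewrite -!catA => /(_ erefl).
by rewrite size_cat count_cat; have := count_size (T x) c2; lia.
Qed.

Lemma median_in w0 c D w3 x : median (w0 ++ D ++ c ++ w3) ->
  x \in c -> 2 * size c <= size D -> size D <= 4 * count (T^~ x) D.
Proof.
move=> + xc; case/path.splitPr: xc => c1 c2 [_ h]; rewrite size_cat /= => hs.
have := h w0 x (D ++ c1) (c2 ++ w3); rewrite -!catA => /(_ erefl).
by rewrite size_cat count_cat; have := count_size (T^~ x) c1; lia.
Qed.

End Median.

(** * Absorption and the final cycle *)

Section Absorb.
Variables (V : finType) (T : rel V) (k : nat).

Definition long_block (B : seq V) := (k <= size B) && pairwise T B.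

Lemma block_long B : block T k B -> long_block B.
Proof. by case/andP=> /eqP h p; rewrite /long_block -h leqnn. Qed.

Lemma absorb_one v X S R Y :
  cycle (precedes T k) (X ++ S :: R :: Y) -> long_block S -> all (T^~ v) S -> all (T v) R ->
  cycle (precedes T k) (X ++ rcons S v :: R :: Y).
Proof.
move=> + /andP[kS _] Sv vR.
have catC Z : cycle (precedes T k) (X ++ Z) = cycle (precedes T k) (Z ++ X).
  by rewrite -(rot_cycle (size X)) rot_size_cat.
rewrite !catC /= !rcons_path => /andP[tSR /andP[-> hl]].
apply/andP; split.
  apply/allrelP => x z; rewrite mem_rcons inE => /predU1P[->|xS] zR.
    by apply: (allP vR); apply: mem_take zR.
  exact: (allrelP tSR).
by rewrite /=; move: hl; rewrite /precedes -cats1 takel_cat.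
Qed.

Lemma absorb vs : forall qs pre post,
  cycle (precedes T k) (pre ++ flatten qs ++ post) ->
  all long_block (pre ++ flatten qs ++ post) -> size vs <= size qs ->
  {in qs, forall e, {in vs, forall v, serves T e v}} ->
  exists bs, [/\ cycle (precedes T k) bs, all long_block bs &
    perm_eq (flatten bs) (flatten (pre ++ flatten qs ++ post) ++ vs)].
Proof.
elim: vs => [|v vs IH] qs pre post cyc lb sz sv.
  by exists (pre ++ flatten qs ++ post); rewrite cats0.
case: qs sz sv cyc lb => // e qs sz sv cyc lb.
have [e1 [S [R [e2 [ee Sv vR]]]]] := sv e (mem_head _ _) v (mem_head _ _).
have e0 : pre ++ flatten (e :: qs) ++ post = (pre ++ e1) ++ S :: R :: (e2 ++ flatten qs ++ post).
  by rewrite /= ee -!catA.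
have lS : long_block S.
  by move: lb; rewrite e0 all_cat => /andP[_ /andP[]].
have e0' : (pre ++ e1) ++ rcons S v :: R :: (e2 ++ flatten qs ++ post) =
    (pre ++ e1 ++ rcons S v :: R :: e2) ++ flatten qs ++ post by rewrite -!catA.
rewrite e0 in cyc lb *; have := absorb_one cyc lS Sv vR; rewrite e0' => cyc'.
have [|||bs [h1 h2 h3]] := IH qs _ _ cyc'.
- move: lb; rewrite -e0' !all_cat /= => /andP[-> /andP[_ ->]].
  case/andP: lS => kS pS; rewrite /long_block pairwise_rcons pS Sv size_rcons.
  by rewrite leqW.
- by [].
- by move=> e' e'q u uv; apply: sv; rewrite inE ?e'q ?uv orbT.
exists bs; split=> //; apply: (perm_trans h3); apply/permP => p.
by rewrite -e0' !flatten_cat /= !flatten_cat -cats1 !count_cat /= ?flatten_cat ?count_cat; lia.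
Qed.

(** As blocks have at least [k] vertices, positions at distance at most [k] lie in one block or in
    two consecutive ones, and in the latter case the second position is among the first [k] of its
    block. *)
Lemma nth_path_blocks x0 B q i j :
  path (precedes T k) B q -> all long_block (B :: q) ->
  i < j -> j <= i + k -> j < size (flatten (B :: q)) ->
  T (nth x0 (flatten (B :: q)) i) (nth x0 (flatten (B :: q)) j).
Proof.
elim: q B i j => [|C q IH] B i j pq lb ij jk js.
  move: lb js; rewrite /= cats0 andbT => /andP[_ /(pairwiseP x0) h] js.
  by apply: h => //; apply: ltn_trans js.
have /and3P[/andP[kB pB] /andP[kC pC] _] := lb.
have eB : flatten (B :: C :: q) = B ++ flatten (C :: q) by [].
rewrite eB !(nth_cat _ B).
have [jB|jB] := ltnP j (size B).
  by rewrite (ltn_trans ij jB); move/(pairwiseP x0): pB; apply=> //; apply: ltn_trans jB.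
case/andP: pq => tBC pq; have [iB|iB] := ltnP i (size B).
  have jC : j - size B < k by lia.
  rewrite [flatten (C :: q)]/= nth_cat (leq_trans jC kC); apply: (allrelP tBC); first exact: mem_nth.
  rewrite -(nth_take _ jC); apply: mem_nth; by rewrite size_take_min leq_min jC (leq_trans jC kC).
apply: (IH C (i - size B) (j - size B)) => //; first by case/andP: lb.
- by lia.
- by lia.
- by move: js; rewrite eB size_cat; lia.
Qed.

Lemma cycle_blocks_hamilton bs : 0 < k -> cycle (precedes T k) bs -> all long_block bs ->
  perm_eq (flatten bs) (enum V) -> 0 < #|V| -> has_hamilton_cycle_power k T.
Proof.
move=> k0; case: bs => [|B q] cyc lb pe V0.
  by move/perm_size: pe; rewrite -cardE /= => h; rewrite -h in V0.
set s := flatten (B :: q) in pe.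
have ss : size s = #|V| by rewrite (perm_size pe) -cardE.
have us : uniq s by rewrite (perm_uniq pe) enum_uniq.
case/card_gt0P: (V0) => x0 _.
exists (fun i => nth x0 s i); split.
  apply: inj_card_bij; last by rewrite card_ord.
  by move=> i j /eqP; rewrite nth_uniq ?ss // => /eqP/val_inj.
move=> i j [_ [d [d1 dk jd]]].
(* The cycle is unrolled by repeating its first block; that block has at least [k] vertices, so
   every edge that wraps around becomes an edge of the path. *)
have es : flatten (B :: rcons q B) = s ++ B by rewrite -cats1 /= flatten_cat /= cats0 catA.
have lb' : all long_block (B :: rcons q B).
  by move: lb; rewrite /= all_rcons => /andP[-> ->].
have kB : k <= size B by case/andP: lb => /andP[].
have Bs : size B <= size s by rewrite /s /= size_cat leq_addr.
have := @nth_path_blocks x0 B (rcons q B) i (i + d) cyc lb'; rewrite es.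
have in_ : i < size s by rewrite ss.
have {}jd : j = (i + d) %% size s :> nat by rewrite ss.
rewrite nth_cat in_ => h.
have {}h := h _ _ _; have := h ltac:(lia) ltac:(lia) ltac:(rewrite size_cat; lia).
congr T; rewrite nth_cat jd; have [hl|hl] := ltnP (i + d) (size s); first by rewrite modn_small.
rewrite -{2}(subnK hl) modnDr modn_small; last by lia.
by rewrite {2}/s /= nth_cat (_ : i + d - size s < size B) //; lia.
Qed.

End Absorb.

(** * Linking, absorbing and covering *)

Section Expander.
Variables (V : finType) (T : rel V) (k y n E : nat).
Hypothesis hT : is_tournament T.
Hypothesis n_card : n = #|V|.
Hypothesis k2 : 2 <= k.
Hypothesis hE : 100 <= E.
Hypothesis hEy : 100 * E <= y.
Hypothesis h2ky : 2 ^ k <= y.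
Hypothesis hky : 2 * k <= y.
Hypothesis le_n : forall a, a <= 70 -> y ^ a <= n.
Hypothesis hlog : forall c, y <= c -> n < 2 ^ (72 * c).
Hypothesis hout : forall v, n <= 5 * #|[set w | T v w]|.
Hypothesis hin : forall v, n <= 5 * #|[set w | T w v]|.
Hypothesis hexp : forall X Y : {set V},
  [disjoint X & Y] -> E * #|~: (X :|: Y)| <= n ->
  n <= 10 * #|X| -> n <= 10 * #|Y| ->
  n <= E * #|[set x in X | n <= E * #|[set y in Y | T x y]|]|.
(** The limit [5 * E] comes from the costliest use, where a degree share [1 / E] from expansion is
    combined with a share [1 / 5] from the semidegree. *)
Hypothesis hdrc : forall b (Y : finType) (r : V -> Y -> bool) (A : {set V}) (B : {set Y}),
  0 < b -> b <= 5 * E -> 0 < #|B| -> y <= #|A| ->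
  (forall x, x \in A -> #|B| <= b * #|[set z in B | r x z]|) ->
  exists S, [/\ size S = k, pairwise T S, {subset S <= A} &
    #|B| <= y * #|[set z in B | all (r^~ z) S]|].

Local Notation block := (block T k).
Local Notation chain := (chain T k).
Local Notation serves := (serves T).
Local Notation open_chain := (open_chain T k).

Definition cout (S : seq V) := [set z | all (T^~ z) S].
Definition cin (S : seq V) := [set z | all (T z) S].

Lemma y_gt0 : 0 < y. Proof. by lia. Qed.

(* The layers around [B] are nested: among [h.+1 * y] vertices of a layer either
   [y] are new or [h * y] lie in the previous layer, so a threshold that is only
   linear in the number of layers suffices. *)
Definition reach (B : {set V}) h (D : {set V}) := forall A : {set V},
  A \subset D -> h * y <= #|A| -> exists S l,
  [/\ chain (S :: l), {subset S <= A}, {subset last S l <= B},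
      {subset flatten (S :: l) <= D} & size l < h].

Lemma reach1 B : reach B 1 B.
Proof.
move=> A sA; rewrite mul1n => hA.
have [S [sS pS iS]] := ramsey hT (leq_trans h2ky hA).
exists S, [::]; split=> //=.
- by apply: chain1; [case: hT|rewrite /block sS eqxx].
- by move=> x /iS; apply: (subsetP sA).
- by move=> x; rewrite cats0 => /iS; apply: (subsetP sA).
Qed.

Lemma reachS B h (D D' : {set V}) b : 0 < b -> b <= 5 * E ->
  D \subset D' -> h * y * y <= #|D| -> 0 < #|D| ->
  (forall v, v \in D' :\: D -> #|D| <= b * #|[set z in D | T v z]|) ->
  reach B h D -> reach B h.+1 D'.
Proof.
move=> b0 hb sD hD D0 hdeg hr A sA hA.
have [h1|h1] := leqP (h * y) #|A :&: D|.
  have [|S [l [c1 c2 c3 c4 c5]]] := hr (A :&: D) _ h1; first exact: subsetIr.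
  exists S, l; split=> //; last exact: ltnW.
    by move=> x /c2; rewrite inE => /andP[].
  by move=> x /c4; apply: (subsetP sD).
have hA' : y <= #|A :\: D| by have := cardsID D A; lia.
have [|S [sS pS iS hC]] := @hdrc b V T (A :\: D) D b0 hb D0 hA'.
  by move=> x; rewrite inE => /andP[xD xA]; apply: hdeg; rewrite inE xD (subsetP sA).
set C := [set z in D | _] in hC.
have hCy : h * y <= #|C| by rewrite -(leq_pmul2l y_gt0) mulnC (leq_trans hD).
have [|R [l [c1 c2 c3 c4 c5]]] := hr C _ hCy; first by apply/subsetP => x; rewrite inE => /andP[].
have bS : block S by rewrite /block sS eqxx.
exists S, (R :: l); split=> //.
- rewrite -cat1s; apply: chain_cat => //.
  + by apply: chain1 => //; case: hT.
  + move=> _ _ _ _ /=; apply/allrel_precedes/allrelP => x z xS /c2.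
    by rewrite inE => /andP[_ /allP]; apply.
  + rewrite /= cats0; apply/hasPn => x /c4 xD; apply/negP => /iS; rewrite inE xD //.
- by move=> x /iS; rewrite inE => /andP[].
- move=> x; rewrite /= mem_cat => /orP[/iS|/c4]; last exact: (subsetP sD).
  by rewrite inE => /andP[_]; apply: (subsetP sA).
Qed.

Lemma card_restrict (P : pred V) (D : {set V}) :
  #|[set w | P w]| <= #|[set w in D | P w]| + #|~: D|.
Proof.
rewrite -(cardsID D [set w | P w]) leq_add //; apply/subset_leq_card/subsetP => x.
  by rewrite !inE andbC.
by rewrite !inE => /andP[->].
Qed.

Lemma mul_le_n c (U : {set V}) : c <= y ^ 3 -> y ^ 4 * #|U| <= n -> c * (#|U| + y ^ 2) <= n.
Proof.
move=> hc hU; have y2 : 2 <= y by lia.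
have h1 : 2 * (c * #|U|) <= n.
  by rewrite (leq_trans _ hU) // mulnA leq_mul // (expnS y 3) leq_mul.
have h2 : 2 * (c * y ^ 2) <= n.
  rewrite (leq_trans _ (le_n (a := 6) _)) // mulnA (expnD y 4 2) leq_mul //.
  by rewrite (expnS y 3) leq_mul.
by rewrite mulnDr; lia.
Qed.

(** The search runs backwards from [B]. Expansion from the unreached vertices into the reached ones
    adds [n / E] vertices at a time, so within [E.+1] steps fewer than [n / 10] stay unreached.
    Out-degrees of at least [n / 5] then attach [A] directly. The number of layers is at most
    [E + 4], below [y]. *)
Lemma link (U A B : {set V}) :
  [disjoint A & U] -> [disjoint B & U] -> y ^ 4 * #|U| <= n ->
  y ^ 2 <= #|A| -> y ^ 3 <= #|B| ->
  exists S l, [/\ chain (S :: l), {subset S <= A}, {subset last S l <= B},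
      {subset flatten (S :: l) <= ~: U} & size l < y].
Proof.
move=> dA dB hU hA hB.
(* [A] is trimmed so that it can be excluded from the layers together with [U] at negligible cost;
   [y ^ 2] still exceeds [y] times the number of layers. *)
have [|A' [_ sA cA]] := @subset_between _ set0 A (y ^ 2) (sub0set _); first by rewrite cards0.
pose V' := ~: (U :|: A'); pose B' := B :\: A'.
have y1 : y ^ 2 = y * y by rewrite expnS expn1.
have y3 : y ^ 3 = y * (y * y) by rewrite expnS y1.
have yE : 1000 <= y by lia.
have small c : c <= y ^ 3 -> c * #|U :|: A'| <= n.
  move=> hc; rewrite (leq_trans _ (mul_le_n hc hU)) // leq_mul2l -cA.
  by rewrite leq_card_setU orbT.
have hB' : y ^ 2 <= #|B'|.
  by rewrite /B'; have := cardsID A' B; have := subset_leq_card (subsetIr B A'); nia.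
have B'V : B' \subset V'.
  apply/subsetP => x; rewrite !inE negb_or => /andP[-> xB]; rewrite andbT.
  by apply/negP => xU; have /pred0P/(_ x) := dB; rewrite /= xB xU.
have n0 : 0 < n by rewrite (leq_trans _ (le_n (a := 0) isT)).
have B0 : 0 < #|B'| by rewrite (leq_trans _ hB') // expn_gt0; lia.
have cV (W : {set V}) : #|W| <= n by rewrite n_card max_card.
(* [B'] may be far too small for expansion. Averaging the in-degrees of its vertices yields a first
   layer of linear size. *)
pose H := [set v in V' | #|B'| <= 20 * #|[set z in B' | T v z]|].
have hH : n <= 10 * #|H|.
  have h1 : #|B'| * n <= 5 * (\sum_(v in V') #|[set z in B' | T v z]| + #|B'| * #|U :|: A'|).
    rewrite sum_card_rel -[#|B'| * n]sum_nat_const -[#|B'| * #|_|]sum_nat_const -big_split big_distrr /=.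
    apply: leq_sum => b _; rewrite (leq_trans (hin b)) // leq_mul2l /=.
    by rewrite (leq_trans (card_restrict _ V')) // setCK.
  have := @sum_le_heavy _ V' (fun v => 20 * #|[set z in B' | T v z]|) (20 * #|B'|) #|B'|.
  rewrite -big_distrr /= -/H => h2.
  have {h2}/h2 h2 : forall x, x \in V' -> 20 * #|[set z in B' | T x z]| <= 20 * #|B'|.
    by move=> x _; rewrite leq_mul2l /=; apply/subset_leq_card/subsetP => z; rewrite inE => /andP[].
  have h3 : 100 * #|U :|: A'| <= n by apply: small; rewrite y3; nia.
  have h4 : #|V'| * #|B'| <= n * #|B'| by rewrite leq_mul2r cV orbT.
  have h5 : #|B'| * (100 * #|U :|: A'|) <= #|B'| * n by rewrite leq_mul2l h3 orbT.
  rewrite -(leq_pmul2l B0); move: h1 h2 h4 h5; clear.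
  move: (\sum_(_ in _) _) => s; lia.
have r1 : reach B' 2 (B' :|: H).
  apply: (reachS (b := 20)); [by []|by lia|exact: subsetUl|by rewrite mul1n -y1|by []| |exact: reach1].
  by move=> v; rewrite !inE => /andP[/negbTE->] /= /andP[].
have claim j : j <= E.+1 -> exists h (D : {set V}), [/\ h <= j + 2, D \subset V', n <= 10 * #|D|, reach B' h D &
    (10 * #|V' :\: D| < n) || (j * n <= E * #|D|)].
  elim: j => [_|j IH hj].
    exists 2, (B' :|: H); rewrite mul0n orbT; split=> //.
    - by rewrite subUset B'V; apply/subsetP => x; rewrite inE => /andP[].
    - by rewrite (leq_trans hH) // leq_mul2l subset_leq_card // subsetUr.
  have [h [D [hh DV nD rD /orP[hD|hD]]]] := IH (ltnW hj).
    by exists h, D; rewrite hD; split=> //; lia.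
  have [hlt|hge] := ltnP (10 * #|V' :\: D|) n.
    by exists h, D; rewrite hlt; split=> //; lia.
  have dXY : [disjoint V' :\: D & D] by rewrite disjoints_subset setDE subsetIr.
  have hE' : E * #|~: ((V' :\: D) :|: D)| <= n.
    have -> : V' :\: D :|: D = V'.
      by apply/setP => x; rewrite in_setU in_setD; case: (boolP (x \in D)) => [/(subsetP DV)->|_]; rewrite ?orbT ?orbF.
    rewrite setCK.
    by apply: small; rewrite y3; nia.
  have := hexp dXY hE' hge nD.
  set H' := [set x in _ | _] => hH'.
  have dH : #|D :|: H'| = #|D| + #|H'|.
    rewrite cardsU (_ : D :&: H' = set0) ?cards0 ?subn0 //.
    apply/setP => x; rewrite !inE; case: (x \in D) => //=.
  exists h.+1, (D :|: H'); split.
  - by lia.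
  - by rewrite subUset DV; apply/subsetP => x; rewrite !inE => /andP[/andP[]].
  - by rewrite (leq_trans nD) // leq_mul2l subset_leq_card // subsetUl.
  - apply: (reachS (b := E) _ _ (subsetUl _ _)) rD; first by lia.
    + by lia.
    + have := le_n (a := 4) isT; rewrite !expnS expn0 => hn4.
      have h5 : h * y * y <= y * y * y by rewrite -!mulnA leq_mul //; lia.
      have h6 : 10 * (y * (y * y)) <= y * (y * (y * y)) by rewrite leq_mul //; lia.
      lia.
    + by lia.
    + move=> v; rewrite !inE => /andP[/negbTE->] /= /andP[_]; exact: leq_trans.
  - by apply/orP; right; rewrite dH mulSn mulnDr addnC leq_add.
have [h [D [hh DV nD rD hD]]] := claim E.+1 (leqnn _).
have {}hD : 10 * #|V' :\: D| < n.
  case/orP: hD => // hD; have := leq_mul (leqnn E) (cV D); nia.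
have h4 := le_n (a := 4) isT.
have hDy : h * y * y <= #|D|.
  rewrite -(leq_pmul2l (m := 10)) // (leq_trans _ nD) // (leq_trans _ h4) //.
  by rewrite -!mulnA (expnS y 3) y3; apply: leq_mul; [lia|apply: leq_mul; lia].
have A0 : reach B' h.+1 (D :|: A').
  apply: (reachS (b := 20) _ _ (subsetUl _ _)) rD => //; first by lia.
    by lia.
  move=> v _; have := hout v; have := card_restrict (T v) D.
  have : #|~: D| <= #|V' :\: D| + #|U :|: A'|.
    rewrite (leq_trans _ (leq_card_setU _ _)) // subset_leq_card //.
    by apply/subsetP => x; rewrite !inE => ->; rewrite andTb orNb.
  have h3 : 100 * #|U :|: A'| <= n by apply: small; rewrite y3; nia.
  by have := cV D; lia.
have [|S [l [c1 c2 c3 c4 c5]]] := A0 A' (subsetUr _ _).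
  by rewrite cA y1 leq_mul //; lia.
exists S, l; split=> //.
- by move=> x /c2; apply: (subsetP sA).
- by move=> x /c3; rewrite inE => /andP[].
- move=> x /c4; rewrite !inE => /orP[/(subsetP DV)|/(subsetP sA) xA].
    by rewrite !inE negb_or => /andP[].
  by apply/negP => xU; have /pred0P/(_ x) := dA; rewrite /= xA xU.
- by lia.
Qed.

Let yE : 1000 <= y. Proof. by lia. Qed.
Let n0 : 0 < n. Proof. by rewrite (leq_trans _ (le_n (a := 0) isT)). Qed.
Let cV (W : {set V}) : #|W| <= n. Proof. by rewrite n_card max_card. Qed.

(** Budget rule for forbidden sets: enlarging one by a power of [y] costs one exponent. This
    explains the descending exponents in the hypotheses on [U] below. *)
Lemma mul_add_le a j u w : a + j < 70 -> y ^ a.+1 * u <= n -> w <= y ^ j ->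
  y ^ a * (u + w) <= n.
Proof.
move=> haj hu hw.
have h1 : 2 * (y ^ a * u) <= n.
  by rewrite (leq_trans _ hu) // expnS mulnA !leq_mul //; lia.
have h2 : 2 * (y ^ a * w) <= n.
  rewrite (leq_trans _ (le_n haj)) // -addSn expnD expnS mulnA leq_mul //.
  by rewrite leq_mul //; lia.
by rewrite mulnDr; lia.
Qed.

(** Use pairs as targets: degrees multiply, and the common targets form a rectangle. A rectangle
    filling a share [1 / y] of [setX B1 B2] has both sides at least that share. *)
Lemma drc2 b1 b2 (Y1 Y2 : finType) (r1 : V -> Y1 -> bool) (r2 : V -> Y2 -> bool)
    (A : {set V}) (B1 : {set Y1}) (B2 : {set Y2}) :
  0 < b1 -> 0 < b2 -> b1 * b2 <= 5 * E -> 0 < #|B1| -> 0 < #|B2| -> y <= #|A| ->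
  (forall x, x \in A -> #|B1| <= b1 * #|[set z in B1 | r1 x z]|) ->
  (forall x, x \in A -> #|B2| <= b2 * #|[set z in B2 | r2 x z]|) ->
  exists S, [/\ block S, {subset S <= A},
    #|B1| <= y * #|[set z in B1 | all (r1^~ z) S]| &
    #|B2| <= y * #|[set z in B2 | all (r2^~ z) S]|].
Proof.
move=> b1_0 b2_0 hb B1_0 B2_0 hA h1 h2.
pose r x (z : Y1 * Y2) := r1 x z.1 && r2 x z.2.
have pX (P1 : pred Y1) (P2 : pred Y2) : #|[set z in setX B1 B2 | P1 z.1 && P2 z.2]| =
    #|[set z in B1 | P1 z]| * #|[set z in B2 | P2 z]|.
  rewrite -cardsX; apply: eq_card => -[a b]; rewrite !inE /=.
  by case: (a \in B1); case: (b \in B2); case: (P1 a); case: (P2 b).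
have [|||S [sS pS iS hS]] := @hdrc (b1 * b2) _ r A (setX B1 B2) _ hb _ hA.
- by rewrite muln_gt0 b1_0.
- by rewrite cardsX muln_gt0 B1_0.
- move=> x xA; rewrite /r (pX (r1 x) (r2 x)) cardsX mulnACA.
  by rewrite leq_mul ?h1 ?h2.
have e : #|[set z in setX B1 B2 | all (r^~ z) S]| =
    #|[set z in B1 | all (r1^~ z) S]| * #|[set z in B2 | all (r2^~ z) S]|.
  rewrite -(pX (fun z => all (r1^~ z) S) (fun z => all (r2^~ z) S)).
  by apply: eq_card => z; rewrite !inE /r all_predI.
rewrite e cardsX in hS.
have c1 : #|[set z in B1 | all (r1^~ z) S]| <= #|B1|.
  by apply/subset_leq_card/subsetP => z; rewrite inE => /andP[].
have c2 : #|[set z in B2 | all (r2^~ z) S]| <= #|B2|.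
  by apply/subset_leq_card/subsetP => z; rewrite inE => /andP[].
exists S; split=> //; first by rewrite /block sS eqxx.
  rewrite -(leq_pmul2r B2_0) (leq_trans hS) // -mulnA leq_mul //.
  by rewrite leq_mul2l c2 orbT.
by rewrite -(leq_pmul2l B1_0) (leq_trans hS) // mulnCA leq_mul.
Qed.

(** [Bd] is a set of demands: [S] meets a share [1 / y] of them at once, while its common
    [g]-neighbourhood stays large enough for [join]. Averaging first finds [n / 12] vertices that
    each meet a twelfth of the demands. *)
Lemma hitting_block (J : finType) (Bd : {set J}) (r : V -> J -> bool) (g : V -> V -> bool)
    (U : {set V}) :
  0 < #|Bd| -> y * #|U| <= n ->
  (forall z, z \in Bd -> n <= 5 * #|[set x | r x z]|) ->
  (forall x, n <= 5 * #|[set w | g x w]|) ->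
  exists S, [/\ block S, {subset S <= ~: U},
    #|Bd| <= y * #|[set z in Bd | all (r^~ z) S]| &
    n <= y * #|[set w | all (g^~ w) S]|].
Proof.
move=> Bd0 hU hr hg.
have h100 : 100 * #|U| <= n by rewrite (leq_trans _ hU) // leq_mul2r; apply/orP; right; lia.
pose H := [set x in ~: U | #|Bd| <= 12 * #|[set z in Bd | r x z]|].
have hH : n <= 12 * #|H|.
  have h1 : #|Bd| * n <= 5 * (\sum_(v in ~: U) #|[set z in Bd | r v z]| + #|Bd| * #|U|).
    rewrite sum_card_rel -[#|Bd| * n]sum_nat_const -[#|Bd| * #|_|]sum_nat_const.
    rewrite -big_split big_distrr /=.
    apply: leq_sum => b bB; rewrite (leq_trans (hr b bB)) // leq_mul2l /=.
    by rewrite (leq_trans (card_restrict _ (~: U))) // setCK.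
  have := @sum_le_heavy _ (~: U) (fun v => 12 * #|[set z in Bd | r v z]|) (12 * #|Bd|) #|Bd|.
  rewrite -big_distrr /= -/H => h2.
  have {h2}/h2 h2 : forall x, x \in ~: U -> 12 * #|[set z in Bd | r x z]| <= 12 * #|Bd|.
    by move=> x _; rewrite leq_mul2l /=; apply/subset_leq_card/subsetP => z; rewrite inE => /andP[].
  have h4 : #|~: U| * #|Bd| <= n * #|Bd| by rewrite leq_mul2r cV orbT.
  have h5 : #|Bd| * (100 * #|U|) <= #|Bd| * n by rewrite leq_mul2l h100 orbT.
  rewrite -(leq_pmul2l Bd0); move: h1 h2 h4 h5; clear.
  move: (\sum_(_ in _) _) => s; lia.
have hyH : y <= #|H|.
  have := le_n (a := 2) isT; rewrite expnS expn1 => hyy.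
  have : 12 * y <= y * y by rewrite leq_mul2r; apply/orP; right; lia.
  by lia.
have [||||S [bS iS c1 c2]] := @drc2 12 5 _ _ r g H Bd setT isT isT _ Bd0 _ hyH.
- by lia.
- by rewrite cardsT -n_card.
- by move=> x; rewrite inE => /andP[].
- move=> x _; rewrite cardsT -n_card (leq_trans (hg x)) // leq_mul2l /=.
  by apply/subset_leq_card/subsetP => w; rewrite !inE.
exists S; split=> //; first by move=> x /iS; rewrite inE => /andP[].
rewrite cardsT -n_card in c2; rewrite (leq_trans c2) // leq_mul2l.
by apply/orP; right; apply/subset_leq_card/subsetP => w; rewrite !inE.
Qed.

Lemma join (U : {set V}) S R : y ^ 5 * #|U| <= n ->
  n <= y * #|cout S| -> n <= y * #|cin R| ->
  exists S0 l, [/\ chain (S0 :: l), allrel T S S0, allrel T (last S0 l) R,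
    {subset flatten (S0 :: l) <= ~: U} & size l < y].
Proof.
move=> hU hS hR.
have big (A : {set V}) : n <= y * #|A| -> y ^ 3 <= #|A :\: U|.
  move=> hA; have h1 := cardsID U A; have h2 := subset_leq_card (subsetIr A U).
  have h3 : y * (y * #|U|) <= n.
    rewrite (leq_trans _ hU) // mulnA leq_mul2r; apply/orP; right.
    by rewrite -[y * y]/(y ^ 2) leq_exp2l //; lia.
  have h4 : y * (y ^ 4) <= n by rewrite -expnS; apply: le_n.
  have h5 : 2 * (y * #|U|) <= y * (y * #|U|) by rewrite leq_mul2r; lia.
  have h6 : 2 * y ^ 4 <= y * (y ^ 4) by rewrite leq_mul2r; lia.
  rewrite -(leq_pmul2l (m := y)); last by lia.
  rewrite -expnS.
  have h7 : y * #|A| <= y * (#|A :\: U| + #|U|) by rewrite leq_mul2l; lia.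
  by rewrite mulnDr in h7; lia.
have d1 (A : {set V}) : [disjoint A :\: U & U].
  by rewrite disjoints_subset; apply/subsetP => x; rewrite !inE => /andP[].
have h3 := big _ hS; have h4 := big _ hR.
have [||S0 [l [c1 c2 c3 c4 c5]]] := link (d1 (cout S)) (d1 (cin R)) _ _ h4.
- rewrite (leq_trans _ hU) // leq_mul2r leq_exp2l ?orbT //; lia.
- by rewrite (leq_trans _ h3) // leq_exp2l //; lia.
exists S0, l; split=> //.
  by apply/allrelP => x z xS /c2; rewrite !inE => /andP[_ /allP]; apply.
by apply/allrelP => x z /c3 + zR; rewrite !inE => /andP[_ /allP]; apply.
Qed.

Lemma size_block S : block S -> #|[set x in S]| <= y.
Proof.
case/andP=> /eqP h _; rewrite cardsE (leq_trans (card_size _)) // -h.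
by apply: leq_trans hky; rewrite leq_pmull.
Qed.

(** The first block is chosen for the first coordinates, the last block for the second coordinates
    of the pairs already met. Two losses of [y] give [y ^ 2], and [join] fills the middle. *)
Lemma connector (U : {set V}) (Bd : {set V * V}) :
  0 < #|Bd| -> y ^ 7 * #|U| <= n ->
  exists S l, [/\ chain (S :: l), {subset flatten (S :: l) <= ~: U}, size l <= y.+1 &
    #|Bd| <= y ^ 2 * #|[set p in Bd | all (T p.1) S && all (T^~ p.2) (last S l)]|].
Proof.
move=> Bd0 hU.
have wk a b u : a <= b -> y ^ b * u <= n -> y ^ a * u <= n.
  by move=> hab; apply: leq_trans; rewrite leq_mul2r leq_exp2l ?hab ?orbT //; lia.
have [||S [bS iS cS fS]] := @hitting_block _ Bd (fun x p => T p.1 x) (fun x w => T x w) U Bd0 _ _ hout.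
- by rewrite -[y]expn1; apply: wk hU.
- by move=> p _; apply: hout.
set Bd1 := [set z in Bd | _] in cS.
have Bd10 : 0 < #|Bd1| by move: cS Bd0; case: #|Bd1| => //; rewrite muln0; lia.
pose U1 := U :|: [set x in S].
have hU1 : y ^ 6 * #|U1| <= n.
  rewrite (leq_trans (leq_mul (leqnn _) (leq_card_setU _ _))) //.
  by apply: (mul_add_le (j := 1)) => //; rewrite expn1 size_block.
have [||R [bR iR cR fR]] := @hitting_block _ Bd1 (fun x p => T x p.2) (fun x w => T w x) U1 Bd10 _ _ hin.
- by rewrite -[y]expn1; apply: wk hU1.
- by move=> p _; apply: hin.
pose U2 := U1 :|: [set x in R].
have hU2 : y ^ 5 * #|U2| <= n.
  rewrite (leq_trans (leq_mul (leqnn _) (leq_card_setU _ _))) //.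
  by apply: (mul_add_le (j := 1)) => //; rewrite expn1 size_block.
have [S0 [l [c1 c2 c3 c4 c5]]] := join hU2 fS fR.
have c1S : chain [:: S] by apply: chain1 => //; case: hT.
have c1R : chain [:: R] by apply: chain1 => //; case: hT.
have sub2 x : x \in flatten (S0 :: l) -> (x \notin U) && (x \notin S) && (x \notin R).
  by move/c4; rewrite !inE !negb_or.
exists S, ((S0 :: l) ++ [:: R]); split.
- rewrite -cat1s; apply: chain_cat => //.
  + apply: chain_cat => //.
      by move=> B C _ _; apply: allrel_precedes.
    by apply/hasPn => x; rewrite /= cats0 => xR; apply/negP => /sub2; rewrite xR andbF.
  + by move=> B C _ _; apply: allrel_precedes.
  + apply/hasPn => x; rewrite [flatten [:: S]]cats0 flatten_cat mem_cat.
    case/orP=> [/sub2/andP[/andP[]]//|].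
    by rewrite /= cats0 => /iR; rewrite !inE negb_or => /andP[].
- move=> x; rewrite -cat_cons flatten_cat mem_cat /= cats0 mem_cat => /orP[/orP[/iS//|/sub2]|/iR].
    by rewrite inE => /andP[/andP[]].
  by rewrite !inE negb_or => /andP[].
- by rewrite size_cat /= addn1.
- rewrite last_cat /= (leq_trans cS) // expnS expn1 -mulnA leq_mul2l (leq_trans cR) ?orbT //.
  rewrite leq_mul2l; apply/orP; right; apply/subset_leq_card/subsetP => p.
  by rewrite !inE => /andP[/andP[-> ->] ->].
Qed.

(* [R] is sought inside [Bd] itself: in the tournament induced on [cout S :&: Bd]
   half of the pairs are edges, whatever [Bd] is. *)
Lemma gadget_group (U Bd : {set V}) :
  y ^ 3 <= #|Bd| -> y ^ 2 * #|U| <= n -> Bd \subset ~: U ->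
  exists S R, [/\ block S, block R, {subset S ++ R <= ~: U} & [/\ allrel T S R,
    n <= y * #|cin S|, n <= y * #|cout R| &
    #|Bd| <= y ^ 3 * #|[set v in Bd | all (T^~ v) S && all (T v) R]|]].
Proof.
move=> hBd hU sBd.
have Bd0 : 0 < #|Bd| by rewrite (leq_trans _ hBd) // expn_gt0; lia.
have [||S [bS iS cS fS]] := @hitting_block _ Bd (fun x p => T x p) (fun x w => T w x) U Bd0 _ _ hin.
- by rewrite (leq_trans _ hU) // leq_mul2r expnS expn1 leq_pmulr ?orbT //; lia.
- by move=> p _; apply: hin.
set C := [set z in Bd | _] in cS.
have hC : y ^ 2 <= #|C|.
  by rewrite -(leq_pmul2l (m := y)) -?expnS ?(leq_trans hBd) //; lia.
have C0 : 0 < #|C| by rewrite (leq_trans _ hC) // expn_gt0; lia.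
have hC' : 1000 * y <= #|C|.
  by rewrite (leq_trans _ hC) // expnS expn1 leq_mul2r yE orbT.
pose H := [set c in C | #|C| <= 5 * #|[set z in C | T z c]|].
have hH : y <= #|H|.
  have s1 : #|C| * #|C| = 2 * (\sum_(c in C) #|[set z in C | T z c]|) + #|C|.
    rewrite mul2n -addnn -{1}sum_card_rel -big_split /= -sum_nat_const.
    rewrite -[X in _ = _ + X]muln1 -[X in _ = _ + X]sum_nat_const -big_split /=.
    by apply: eq_bigr => c cC; rewrite {1}(card_out_in hT cC) addn1.
  have := @sum_le_heavy _ C (fun c => 5 * #|[set z in C | T z c]|) (5 * #|C|) #|C|.
  rewrite -big_distrr /= -/H => h2.
  have {h2}/h2 h2 : forall x, x \in C -> 5 * #|[set z in C | T z x]| <= 5 * #|C|.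
    by move=> x _; rewrite leq_mul2l /=; apply/subset_leq_card/subsetP => z; rewrite inE => /andP[].
  have h3 : #|C| <= #|H| * 10 by rewrite -(leq_pmul2l C0); move: s1 h2 C0 hC' yE; clear; move: (\sum_(_ in _) _) => s; nia.
  by lia.
have [||||R [bR iR c1 c2]] := @drc2 5 5 _ _ (fun x z => T z x) T H C setT isT isT _ C0 _ hH.
- by lia.
- by rewrite cardsT -n_card.
- by move=> x; rewrite inE => /andP[].
- move=> x _; rewrite cardsT -n_card (leq_trans (hout x)) // leq_mul2l /=.
  by apply/subset_leq_card/subsetP => w; rewrite !inE.
have iRC x : x \in R -> x \in C by move/iR; rewrite inE => /andP[].
exists S, R; split=> //; last split.
- move=> x; rewrite mem_cat => /orP[/iS//|/iRC].
  by rewrite inE => /andP[/(subsetP sBd)].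
- by apply/allrelP => x z xS /iRC; rewrite inE => /andP[_ /allP]; apply.
- exact: fS.
- rewrite cardsT -n_card in c2; rewrite (leq_trans c2) // leq_mul2l.
  by apply/orP; right; apply/subset_leq_card/subsetP => w; rewrite !inE.
- rewrite (leq_trans cS) // expnS -mulnA leq_mul2l (leq_trans c1) ?orbT //.
  rewrite expnS expn1 -mulnA leq_mul2l; apply/orP; right.
  set s := #|_|; apply: (leq_trans (n := #|[set v in Bd | all (T^~ v) S && all (T v) R]|)).
    apply/subset_leq_card/subsetP => p; rewrite !inE => /andP[/andP[-> ->]] //.
  by rewrite leq_pmull //; lia.
Qed.

(** [S] must come from the in-neighbours of [v] and [R] from its out-neighbours. Outside [U] these
    two sets miss only [v], so expansion from the first to the second applies. *)
Lemma gadget1 (U : {set V}) v : y ^ 2 * #|U| <= n ->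
  exists S R, [/\ block S, block R, {subset S ++ R <= ~: U} & [/\ allrel T S R,
    n <= y * #|cin S|, n <= y * #|cout R| & all (T^~ v) S && all (T v) R]].
Proof.
move=> hU.
pose X := [set x in ~: U | T x v]; pose Y := [set x in ~: U | T v x].
have y2 : y ^ 2 = y * y by rewrite expnS expn1.
have hyU : 1000 * (E * #|U|) <= n.
  by rewrite (leq_trans _ hU) // y2 mulnA leq_mul2r; apply/orP; right; nia.
have hE1 : 1000 * E <= n.
  by rewrite (leq_trans _ (le_n (a := 2) isT)) // y2; nia.
have hUE : #|U| <= E * #|U| by rewrite leq_pmull //; lia.
have hX : n <= 10 * #|X|.
  by have := hin v; have := card_restrict (T^~ v) (~: U); rewrite setCK -/X; lia.
have hY : n <= 10 * #|Y|.
  by have := hout v; have := card_restrict (T v) (~: U); rewrite setCK -/Y; lia.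
have dXY : [disjoint X & Y].
  apply/pred0P => x; rewrite /= !inE; case: (eqVneq x v) => [->|xv].
    by rewrite (tour_irr hT) andbF.
  by rewrite (tour_neg hT xv); case: (T x v); rewrite ?andbF.
have cXY : E * #|~: (X :|: Y)| <= n.
  have : #|~: (X :|: Y)| <= #|U| + 1.
    rewrite -(cards1 v) (leq_trans _ (leq_card_setU _ _)) // subset_leq_card //.
    apply/subsetP => x; rewrite !inE; case: (eqVneq x v) => [->|xv]; rewrite ?orbT //.
    by rewrite (tour_neg hT xv); case: (x \in U); case: (T x v).
  have : E * (#|U| + 1) <= n by lia.
  by move=> h1 h2; rewrite (leq_trans _ h1) // leq_mul2l h2 orbT.
have := hexp dXY cXY hX hY; set H := [set x in X | _] => hH.
have hyH : y <= #|H|.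
  have e0 : 0 < E by lia.
  rewrite -(leq_pmul2l e0) (leq_trans _ hH) // (leq_trans _ (le_n (a := 2) isT)) //.
  by rewrite y2 leq_mul2r; lia.
have Y0 : 0 < #|Y| by lia.
have [|||||S [bS iS c1 c2]] := @drc2 E 5 _ _ T (fun x z => T z x) H Y setT _ isT _ Y0 _ hyH.
- by lia.
- by lia.
- by rewrite cardsT -n_card.
- by move=> x; rewrite inE => /andP[_]; apply: leq_trans.
- move=> x _; rewrite cardsT -n_card (leq_trans (hin x)) // leq_mul2l /=.
  by apply/subset_leq_card/subsetP => w; rewrite !inE.
set C := [set z in Y | _] in c1.
have hC : y <= #|C|.
  have y0 : 0 < y by lia.
  rewrite -(leq_pmul2l y0) -(leq_pmul2l (m := 10)) //.
  apply: (leq_trans (n := n)); last by lia.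
  rewrite (leq_trans _ (le_n (a := 3) isT)) // expnS y2 leq_mul //.
  by lia.
have [|||R [sR pR iR c3]] := @hdrc 5 _ T C setT isT _ _ hC.
- by lia.
- by rewrite cardsT -n_card.
- move=> x _; rewrite cardsT -n_card (leq_trans (hout x)) // leq_mul2l /=.
  by apply/subset_leq_card/subsetP => w; rewrite !inE.
have iSX x : x \in S -> (x \notin U) && T x v.
  by move/iS; rewrite !inE => /andP[].
have iRC x : x \in R -> [/\ x \notin U, T v x & all (T^~ x) S].
  by move/iR; rewrite !inE => /andP[/andP[]].
exists S, R; split=> //; last split.
- by rewrite /block sR eqxx.
- by move=> x; rewrite mem_cat inE => /orP[/iSX/andP[]|/iRC[]].
- by apply/allrelP => x z xS /iRC[_ _ /allP]; apply.
- rewrite cardsT -n_card in c2; rewrite (leq_trans c2) // leq_mul2l.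
  by apply/orP; right; apply/subset_leq_card/subsetP => w; rewrite !inE.
- rewrite cardsT -n_card in c3; rewrite (leq_trans c3) // leq_mul2l.
  by apply/orP; right; apply/subset_leq_card/subsetP => w; rewrite !inE.
- by apply/andP; split; apply/allP => x; [case/iSX/andP|case/iRC].
Qed.

(** Below [y ^ 3] demands, serving a single vertex already is the required share. *)
Lemma gadget (U Bd : {set V}) :
  0 < #|Bd| -> y ^ 2 * #|U| <= n -> Bd \subset ~: U ->
  exists S R, [/\ block S, block R, {subset S ++ R <= ~: U} & [/\ allrel T S R,
    n <= y * #|cin S|, n <= y * #|cout R| &
    #|Bd| <= y ^ 3 * #|[set v in Bd | all (T^~ v) S && all (T v) R]|]].
Proof.
move=> Bd0 hU sBd; have [h|h] := leqP (y ^ 3) #|Bd|; first exact: gadget_group.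
have [v vB] := card_gt0P Bd0.
have [S [R [bS bR iSR [c1 c2 c3 c4]]]] := gadget1 v hU.
exists S, R; split=> //; split=> //.
rewrite (leq_trans (ltnW h)) // leq_pmulr //; apply/card_gt0P; exists v.
by rewrite inE vB.
Qed.

(** * Rounds of connectors and of absorbing gadgets *)

Lemma chain_vertices_le q : chain q -> size q <= y.+3 -> size (flatten q) <= y ^ 3.
Proof.
move=> cq hq; rewrite (size_flatten_chain cq).
have : y.+3 * k <= y ^ 3.
  have h : y.+3 <= y * y by nia.
  by rewrite !expnS expn0 muln1 mulnA leq_mul //; lia.
by apply: leq_trans; rewrite leq_mul2r hq orbT.
Qed.

Definition connects (q : seq (seq V)) (p : V * V) :=
  exists S l, [/\ q = S :: l, all (T p.1) S & all (T^~ p.2) (last S l)].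

Lemma connector_family N (U : {set V}) (Bd : {set V * V}) :
  #|Bd| * (y ^ 2).-1 ^ N < (y ^ 2) ^ N -> y ^ 8 * (#|U| + N * y ^ 3) <= n ->
  exists cs : seq (seq (seq V)), [/\ size cs <= N, {in cs, forall q, chain q},
    uniq (flatten (flatten cs)), {subset flatten (flatten cs) <= ~: U} &
    size (flatten (flatten cs)) <= N * y ^ 3 /\
    forall p, p \in Bd -> exists2 q, q \in cs & connects q p].
Proof.
elim: N U Bd => [|N IH] U Bd hBd hU.
  exists [::]; split=> //; split=> // p pB; exfalso; move: hBd; rewrite !expn0 muln1.
  by rewrite (cardD1 p) pB.
have [Bd0|Bd0] := posnP #|Bd|.
  by exists [::]; split=> //; split=> // p; rewrite (card0_eq Bd0).
have [|S [l [c1 c2 c3 c4]]] := connector (U := U) Bd0.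
  rewrite (leq_trans _ hU) // leq_mul //; last exact: leq_addr.
  by rewrite leq_exp2l //; lia.
set q := S :: l in c1 c2.
set Sv := [set p in Bd | _] in c4.
have sq : size (flatten q) <= y ^ 3 by apply: chain_vertices_le => //=; lia.
have hSq p : p \in Sv -> connects q p.
  by rewrite inE => /andP[_ /andP[? ?]]; exists S, l.
clearbody q.
have cq : #|[set x in flatten q]| <= y ^ 3 by rewrite cardsE (leq_trans (card_size _)).
have hD : #|Bd| = #|Sv| + #|Bd :\: Sv|.
  rewrite -(cardsID Sv Bd); congr addn; congr #|pred_of_set _|.
  by apply/setP => p; rewrite !inE andbA andbb.
have P0 : 0 < y ^ 2 by rewrite expn_gt0; lia.
have hBd' : #|Bd :\: Sv| * (y ^ 2).-1 ^ N < (y ^ 2) ^ N.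
  exact: decay_step hBd hD c4 P0.
have hU' : y ^ 8 * (#|U :|: [set x in flatten q]| + N * y ^ 3) <= n.
  rewrite (leq_trans _ hU) // leq_mul2l; apply/orP; right.
  by rewrite mulSn addnA leq_add2r (leq_trans (leq_card_setU _ _)) // leq_add2l.
have [cs [h1 h2 h3 h4 [h5 h6]]] := IH _ _ hBd' hU'.
exists (q :: cs); split.
- exact: h1.
- by move=> r; rewrite inE => /predU1P[->//|/h2].
- rewrite /= flatten_cat cat_uniq h3 andbT; case/and3P: c1 => _ _ -> /=.
  by apply/hasPn => x /h4; rewrite !inE negb_or => /andP[].
- move=> x; rewrite /= flatten_cat mem_cat => /orP[/c2//|/h4].
  by rewrite !inE negb_or => /andP[].
- split; first by rewrite /= flatten_cat size_cat mulSn leq_add.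
  move=> p pB; have [pS|pS] := boolP (p \in Sv).
    by exists q; [rewrite mem_head|exact: hSq].
  have [|r rcs hr] := h6 p; first by rewrite inE pS.
  by exists r; rewrite // inE rcs orbT.
Qed.

Definition connector_round (cs : seq (seq (seq V))) :=
  [/\ size cs <= y ^ 4, {in cs, forall q, chain q} &
      forall p, exists2 q, q \in cs & connects q p].

Lemma connector_rounds M (U : {set V}) : y ^ 8 * (#|U| + M * y ^ 7) <= n ->
  exists css : seq (seq (seq (seq V))), [/\ size css = M,
    {in css, forall cs, connector_round cs},
    uniq (flatten (flatten (flatten css))),
    {subset flatten (flatten (flatten css)) <= ~: U} &
    size (flatten (flatten (flatten css))) <= M * y ^ 7].
Proof.
elim: M U => [|M IH] U hU; first by exists [::].
(* The demands are all [n ^ 2] pairs, fewer than [2 ^ (2 * 72 * y)], and each connector serves a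
   share [1 / y ^ 2] of those left. *)
have hN : y ^ 2 * (144 * y) <= y ^ 4.
  by rewrite (expnD _ 2 2) leq_mul2l (expnS y 1) expn1 leq_mul2r; lia.
have hBd : #|[set: V * V]| * (y ^ 2).-1 ^ (y ^ 2 * (144 * y)) < (y ^ 2) ^ (y ^ 2 * (144 * y)).
  apply: decay_lt; first by rewrite expn_gt0; lia.
  rewrite cardsT card_prod -n_card (_ : 144 * y = 72 * y + 72 * y); last by lia.
  by rewrite expnD ltn_mul // hlog.
have [|cs [h1 h2 h3 h4 [h5 h6]]] := connector_family (U := U) hBd.
  rewrite (leq_trans _ hU) // leq_mul2l leq_add2l mulSn; apply/orP; right.
  by rewrite (leq_trans _ (leq_addr _ _)) // (expnD y 4 3) leq_mul2r hN orbT.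
have hc : size (flatten (flatten cs)) <= y ^ 7.
  by rewrite (leq_trans h5) // (expnD y 4 3) leq_mul2r hN orbT.
have [|css [g1 g2 g3 g4 g5]] := IH (U :|: [set x in flatten (flatten cs)]).
  rewrite (leq_trans _ hU) // leq_mul2l; apply/orP; right.
  rewrite mulSn addnA leq_add2r (leq_trans (leq_card_setU _ _)) // leq_add2l.
  by rewrite cardsE (leq_trans (card_size _)).
exists (cs :: css); split.
- by rewrite /= g1.
- move=> r; rewrite inE => /predU1P[->|/g2//]; split=> //; first exact: leq_trans hN.
  by move=> p; apply: h6.
- rewrite /= !flatten_cat cat_uniq h3 g3 andbT.
  by apply/hasPn => x /g4; rewrite !inE negb_or => /andP[].
- move=> x; rewrite /= !flatten_cat mem_cat => /orP[/h4//|/g4].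
  by rewrite !inE negb_or => /andP[].
- by rewrite /= !flatten_cat size_cat mulSn leq_add.
Qed.

Lemma gadget_extend S0 q (Bd : {set V}) :
  chain (S0 :: q) -> n <= y * #|cout (last S0 q)| ->
  y ^ 7 * size (flatten (S0 :: q)) <= n -> 0 < #|Bd| ->
  {in Bd, forall v, v \notin flatten (S0 :: q)} ->
  exists e (Sv : {set V}), [/\ chain (S0 :: q ++ e), n <= y * #|cout (last S0 (q ++ e))|,
    size e <= y.+3 & #|Bd| <= y ^ 3 * #|Bd :&: Sv| /\ {in Sv, forall v, serves e v}].
Proof.
move=> cq fq hq Bd0 dB.
pose U := [set x in flatten (S0 :: q)].
have hU : y ^ 7 * #|U| <= n.
  by rewrite (leq_trans _ hq) // leq_mul2l cardsE card_size orbT.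
have [||S [R [bS bR iSR [tSR fS fR hBd]]]] := gadget (U := U) Bd0.
- by rewrite (leq_trans _ hU) // leq_mul2r leq_exp2l ?orbT //; lia.
- by apply/subsetP => v /dB; rewrite !inE.
have irr : irreflexive T by case: hT.
have hSR : #|[set x in S]| + #|[set x in R]| <= y ^ 2.
  rewrite (leq_trans (leq_add (size_block bS) (size_block bR))) // expnS expn1 addnn -mul2n.
  by rewrite leq_mul2r; lia.
have hU' : y ^ 5 * #|U :|: ([set x in S] :|: [set x in R])| <= n.
  apply: (leq_trans (n := y ^ 5 * (#|U| + y ^ 2))).
    rewrite leq_mul2l; apply/orP; right; rewrite (leq_trans (leq_card_setU _ _)) // leq_add2l.
    by rewrite (leq_trans (leq_card_setU _ _)).
  apply: (mul_add_le (j := 2)) => //.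
  by rewrite (leq_trans _ hU) // leq_mul2r leq_exp2l ?orbT //; lia.
have [S1 [l [c1 c2 c3 c4 c5]]] := join hU' fq fS.
have uSR : uniq (S ++ R).
  have /andP[_ pS] := bS; have /andP[_ pR] := bR.
  rewrite cat_uniq (pairwise_uniq irr pS) (pairwise_uniq irr pR) andbT.
  apply/hasPn => x xR; apply/negP => xS; move/allrelP: tSR => /(_ _ _ xS xR).
  by rewrite irr.
have cSR : chain [:: S; R].
  rewrite /chain /= bS bR cats0 uSR !andbT; exact: allrel_precedes.
have nU x : x \in flatten (S1 :: l) -> [&& x \notin U, x \notin S & x \notin R].
  by move/c4; rewrite !inE !negb_or.
have ce : chain ((S1 :: l) ++ [:: S; R]).
  apply: chain_cat => //.
    by move=> B C _ _; apply: allrel_precedes.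
  apply/hasPn => x; rewrite /= cats0 mem_cat => xSR; apply/negP => /nU/and3P[_ hS hR].
  by move: xSR; rewrite (negbTE hS) (negbTE hR).
exists ((S1 :: l) ++ [:: S; R]), [set v | all (T^~ v) S && all (T v) R]; split.
- rewrite -cat_cons; apply: chain_cat => //.
    by move=> B C _ _; apply: allrel_precedes.
  apply/hasPn => x; rewrite flatten_cat mem_cat => /orP[/nU/and3P[]|].
    by rewrite inE.
  by rewrite [flatten [:: S; R]]/= cats0 => /iSR; rewrite !inE.
- by rewrite !last_cat /=.
- by rewrite size_cat /= addn2 !ltnS ltnW.
- split.
    rewrite (leq_trans hBd) // leq_mul2l; apply/orP; right.
    by apply/subset_leq_card/subsetP => v; rewrite !inE.
  by move=> v; rewrite inE => /andP[h1 h2]; exists (S1 :: l), S, R, [::].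
Qed.

(** A gadget may use vertices of [Bd] in its own blocks. Such vertices are dropped from the demands,
    so service is promised only to vertices that end up outside the chain. *)
Lemma gadget_family N S0 q (Bd : {set V}) :
  #|Bd| * (y ^ 3).-1 ^ N < (y ^ 3) ^ N ->
  chain (S0 :: q) -> n <= y * #|cout (last S0 q)| ->
  y ^ 7 * (size (flatten (S0 :: q)) + N * y ^ 3) <= n ->
  exists e, [/\ chain (S0 :: q ++ e), n <= y * #|cout (last S0 (q ++ e))|,
    size (flatten e) <= N * y ^ 3 &
    forall v, v \in Bd -> v \notin flatten (S0 :: q ++ e) -> serves e v].
Proof.
elim: N q Bd => [|N IH] q Bd hBd cq fq hq.
  exists [::]; rewrite cats0; split=> // v vB; exfalso; move: hBd.
  by rewrite !expn0 muln1 (cardD1 v) vB.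
pose Bd' := Bd :\: [set x in flatten (S0 :: q)].
have [Bd0|Bd0] := posnP #|Bd'|.
  exists [::]; rewrite cats0; split=> // v vB vq.
  by have := card0_eq Bd0 v; rewrite inE vB inE vq.
have [||e [Sv [h1 h2 h3 [h4 h5]]]] := gadget_extend cq fq _ Bd0.
- by rewrite (leq_trans _ hq) // leq_mul2l leq_addr orbT.
- by move=> v; rewrite inE => /andP[]; rewrite inE.
have P0 : 0 < y ^ 3 by rewrite expn_gt0; lia.
have sB : #|Bd'| <= #|Bd| by apply/subset_leq_card/subsetDl.
have hBd2 : #|Bd'| * (y ^ 3).-1 ^ N.+1 < (y ^ 3) ^ N.+1.
  by rewrite (leq_ltn_trans _ hBd) // leq_mul2r sB orbT.
have hBd' := decay_step hBd2 (esym (cardsID Sv Bd')) h4 P0.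
have se : size (flatten e) <= y ^ 3.
  apply: chain_vertices_le h3; move: h1; rewrite -cat_cons /chain all_cat.
  case/and3P=> /andP[_ ->] /cat_sorted2[_ ->].
  by rewrite flatten_cat cat_uniq => /and3P[].
have [|e' [g1 g2 g3 g4]] := IH _ _ hBd' h1 h2.
  rewrite (leq_trans _ hq) // leq_mul2l; apply/orP; right.
  by rewrite -cat_cons flatten_cat size_cat mulSn -!addnA leq_add2l leq_add2r.
exists (e ++ e'); rewrite catA; split=> //.
  by rewrite flatten_cat size_cat mulSn leq_add.
move=> v vB vq; have [vS|vS] := boolP (v \in Sv); first exact/serves_catl/h5.
apply/serves_catr/g4 => //; rewrite !inE vS vB andbT.
by move: vq; rewrite -!cat_cons !flatten_cat !mem_cat !negb_or => /andP[/andP[]].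
Qed.

Lemma gadget_rounds M : y ^ 7 * (y ^ 2 + M * y ^ 8) <= n -> exists S0 q0 qs,
  [/\ size qs = M, chain (S0 :: q0 ++ flatten qs), n <= y * #|cin S0|,
    n <= y * #|cout (last S0 (q0 ++ flatten qs))| &
    size (flatten (S0 :: q0 ++ flatten qs)) <= y ^ 2 + M * y ^ 8 /\
    {in qs, forall e v, v \notin flatten (S0 :: q0 ++ flatten qs) -> serves e v}].
Proof.
have irr : irreflexive T by case: hT.
elim: M => [|M IH] hM.
  have /card_gt0P[v _] : 0 < #|V| by rewrite -n_card.
  have [|||S [R [bS bR _ [tSR fS fR _]]]] := gadget (U := set0) (Bd := [set v]).
  - by rewrite cards1.
  - by rewrite cards0 muln0.
  - by rewrite setC0 subsetT.
  have uSR : uniq (S ++ R).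
    have /andP[_ pS] := bS; have /andP[_ pR] := bR.
    rewrite cat_uniq (pairwise_uniq irr pS) (pairwise_uniq irr pR) andbT.
    apply/hasPn => x xR; apply/negP => xS; move/allrelP: tSR => /(_ _ _ xS xR).
    by rewrite irr.
  exists S, [:: R], [::]; split=> //=.
    by rewrite /chain /= bS bR cats0 uSR !andbT; apply: allrel_precedes.
  split=> //; rewrite cats0 size_cat addn0.
  have /andP[/eqP <- _] := bS; have /andP[/eqP <- _] := bR.
  by rewrite addnn -mul2n (leq_trans hky) // expnS leq_pmulr // expn1; lia.
have [|S0 [q0 [qs [h1 h2 h3 h4 [h5 h6]]]]] := IH.
  by rewrite (leq_trans _ hM) // leq_mul2l leq_add2l leq_mul2r leqnSn !orbT.
(* One segment has to serve fewer than [2 ^ (72 * y)] vertices at a share [1 / y ^ 3] per gadget, so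
   [decay_lt] asks for this many gadgets. *)
have hN : y ^ 3 * (72 * y) <= y ^ 5.
  by rewrite (expnD _ 3 2) leq_mul2l (expnS y 1) expn1 leq_mul2r; lia.
have hN' : y ^ 3 * (72 * y) * y ^ 3 <= y ^ 8 by rewrite (expnD y 5 3) leq_mul2r hN orbT.
have hBd : #|[set: V]| * (y ^ 3).-1 ^ (y ^ 3 * (72 * y)) < (y ^ 3) ^ (y ^ 3 * (72 * y)).
  by apply: decay_lt; [rewrite expn_gt0; lia|rewrite cardsT -n_card hlog].
have [|e [g1 g2 g3 g4]] := gadget_family hBd h2 h4.
  rewrite (leq_trans _ hM) // leq_mul2l; apply/orP; right.
  by rewrite mulSn [leqRHS]addnCA [leqRHS]addnC leq_add.
have E0 : q0 ++ flatten (rcons qs e) = (q0 ++ flatten qs) ++ e.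
  by rewrite -cats1 flatten_cat [flatten [:: e]]cats0 catA.
exists S0, q0, (rcons qs e); rewrite E0; split=> //.
  by rewrite size_rcons h1.
split.
  rewrite -cat_cons flatten_cat size_cat mulSn [leqRHS]addnCA [leqRHS]addnC leq_add //.
  exact: leq_trans hN'.
move=> e'; rewrite mem_rcons inE orbC => /orP[e'q|/eqP->] v vq.
  by apply: h6 => //; move: vq; rewrite -cat_cons flatten_cat mem_cat negb_or => /andP[].
by apply: g4.
Qed.

(** * Covering by open chains *)

Lemma split_half (C : {set V}) (D1 D2 : seq V) a : {subset C <= D1 ++ D2} ->
  2 * a <= #|C| -> a <= #|[set z in C | z \in D1]| \/ a <= #|[set z in C | z \in D2]|.
Proof.
move=> sC hC; have : #|C| <= #|[set z in C | z \in D1]| + #|[set z in C | z \in D2]|.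
  rewrite (leq_trans _ (leq_card_setU _ _)) // subset_leq_card //.
  by apply/subsetP => z zC; rewrite !inE zC /= -mem_cat sC.
by move: #|_| #|_| #|_| hC => u v w; lia.
Qed.

(* Dependent random choice keeps a [1 / y] fraction of two consecutive chunks of
   length [y * a], hence at least [a] vertices of one of them. *)
Lemma forward_chain a r w0 c rest (A : {set V}) : y <= a ->
  uniq (w0 ++ c ++ rest) -> median T (w0 ++ c ++ rest) -> size c = y * a ->
  2 * (y * a) * r <= size rest -> {subset A <= c} -> a <= #|A| ->
  exists q Ap, [/\ size q = r, all block q, uniq (flatten q ++ Ap),
    {subset flatten q ++ Ap <= [predU A & rest]} & a <= size Ap /\
    forall B, {in A, forall z, all (T^~ z) B} ->
      path (precedes T k) B q /\ allrel T (last B q) Ap].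
Proof.
move=> hya; elim: r w0 c rest A => [|r IH] w0 c rest A uw mw sc srest sA cA.
  exists [::], (enum A); split=> //; rewrite ?enum_uniq //=.
    by move=> z; rewrite mem_enum inE => ->.
  rewrite -cardE; split=> // B hB; split=> //; apply/allrelP => x z xB.
  by rewrite mem_enum => /hB/allP; apply.
set s := y * a in sc srest.
have hs1 : s <= size rest by lia.
have hs2 : s <= size (drop s rest) by rewrite size_drop; lia.
(* [median_out] wants an interval twice as long as [c], hence two chunks. The chain continues from
   the one holding enough candidates, so a block uses up at most two chunks. *)
pose D1 := take s rest; pose D2 := take s (drop s rest); pose rest' := drop s (drop s rest).
have erest : rest = D1 ++ D2 ++ rest' by rewrite !cat_take_drop.
have sD1 : size D1 = s by rewrite size_take_min (minn_idPl hs1).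
have sD2 : size D2 = s by rewrite size_take_min (minn_idPl hs2).
have srest' : 2 * s * r <= size rest' by rewrite !size_drop; lia.
clearbody D1 D2 rest'; subst rest.
pose D := D1 ++ D2.
have uD : uniq D.
  by move: uw; rewrite !catA -(catA _ D1) cat_uniq => /andP[]; rewrite cat_uniq => /and3P[].
have sD : size D = 2 * s by rewrite size_cat sD1 sD2 mul2n addnn.
have y0 : 0 < y by lia.
have s0 : 0 < s by rewrite muln_gt0 y0; lia.
have cD : #|[set z in D]| = 2 * s by rewrite cardsE (card_uniqP uD).
have [|||S [sS pS iS hC]] := @hdrc 4 _ T A [set z in D] isT _ _ (leq_trans hya cA).
- by lia.
- by rewrite cD muln_gt0.
- move=> x /sA xc; rewrite card_count // cD -sD.
  apply: (median_out (w0 := w0) (c := c) (w3 := rest')) => //; first by rewrite -catA.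
  by rewrite sD sc.
set C := [set z in [set z in D] | _] in hC.
have hCa : 2 * a <= #|C| by rewrite -(leq_pmul2l y0) mulnCA -/s -cD.
have sC : {subset C <= D1 ++ D2} by move=> z; rewrite !inE => /andP[].
have SC : {in C, forall z, all (T^~ z) S} by move=> z; rewrite !inE => /andP[].
have bS : block S by rewrite /block sS eqxx.
have irr : irreflexive T by case: hT.
have SA x : x \in S -> x \notin (D1 ++ D2 ++ rest').
  move/iS/sA => xc; apply/negP => xr; move: uw; rewrite cat_uniq => /and3P[_ _].
  by rewrite cat_uniq => /and3P[_ /hasPn/(_ _ xr)]; rewrite /= xc.
have main (C' : {set V}) q Ap : {subset C' <= C} -> size q = r -> all block q -> uniq (flatten q ++ Ap) ->
    {subset flatten q ++ Ap <= D1 ++ D2 ++ rest'} -> a <= size Ap ->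
    (forall B, {in C', forall z, all (T^~ z) B} ->
      path (precedes T k) B q /\ allrel T (last B q) Ap) ->
    exists q Ap, [/\ size q = r.+1, all block q, uniq (flatten q ++ Ap),
    {subset flatten q ++ Ap <= [predU A & D1 ++ D2 ++ rest']} & a <= size Ap /\
    forall B, {in A, forall z, all (T^~ z) B} ->
      path (precedes T k) B q /\ allrel T (last B q) Ap].
  move=> sC' hq bq uq sq hAp hB; exists (S :: q), Ap; split.
  - by rewrite /= hq.
  - by rewrite /= bS.
  - rewrite /= -catA cat_uniq uq (pairwise_uniq irr pS) andbT /=.
    by apply/hasPn => x /sq xr; apply/negP => /SA; rewrite xr.
  - by move=> x; rewrite /= -catA mem_cat inE /= => /orP[/iS->//|/sq->]; rewrite orbT.
  split=> // B BA /=; have [|hp ha] := hB S; first by move=> z /sC'/SC.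
  rewrite hp andbT; split=> //; apply/allrel_precedes/allrelP => x z xB /iS /BA /allP; exact.
have [hC1|hC2] := split_half sC hCa.
  have [||||||q [Ap [h1 h2 h3 h4 [h5 h6]]]] := IH (w0 ++ c) D1 (D2 ++ rest') [set z in C | z \in D1].
  - by rewrite -!catA in uw *.
  - by rewrite -!catA in mw *.
  - exact: sD1.
  - by rewrite size_cat (leq_trans srest') // leq_addl.
  - by move=> z; rewrite inE => /andP[].
  - exact: hC1.
  apply: (main [set z in C | z \in D1] q Ap) => //; first by move=> z; rewrite inE => /andP[].
  by move=> z /h4; rewrite !inE mem_cat => /orP[/andP[_ ->]//|->]; rewrite orbT.
have [||||||q [Ap [h1 h2 h3 h4 [h5 h6]]]] := IH (w0 ++ c ++ D1) D2 rest' [set z in C | z \in D2].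
- by rewrite -!catA in uw *.
- by rewrite -!catA in mw *.
- exact: sD2.
- exact: srest'.
- by move=> z; rewrite inE => /andP[].
- exact: hC2.
apply: (main [set z in C | z \in D2] q Ap) => //; first by move=> z; rewrite inE => /andP[].
by move=> z /h4; rewrite !inE !mem_cat => /orP[/andP[_ ->]|->]; rewrite ?orbT.
Qed.

(* An open chain [(Am, R, q, Ap)]: every vertex of [Am] can precede the chain
   [R :: q] and every vertex of [Ap] can follow it. *)
Lemma open_chain_exists a r (W : {set V}) : y <= a -> (5 + 2 * r) * (y * a) <= #|W| ->
  exists p, [/\ open_chain a p, {subset oc_vertices p <= W} & size (oc_blocks p) = r.+1].
Proof.
move=> hya hW; set s := y * a in hW.
have [w pw mw] := median_order hT (enum_uniq W).
have uw : uniq w by rewrite (perm_uniq pw) enum_uniq.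
have wW : w =i W by move=> x; rewrite (perm_mem pw) mem_enum.
have sw : (5 + 2 * r) * s <= size w by rewrite (perm_size pw) -cardE.
(* The chain starts from [c]. It needs [D0], of length [2 * s], for the candidates before it and two
   chunks after it; with [c] itself this is the 5 in the bound. *)
pose D0 := take (2 * s) w; pose w1 := drop (2 * s) w.
pose c := take s w1; pose w2 := drop s w1.
pose D1 := take s w2; pose w3 := drop s w2.
pose D2 := take s w3; pose rest := drop s w3.
have ew : w = D0 ++ c ++ D1 ++ D2 ++ rest by rewrite !cat_take_drop.
have hw1 : size w1 = size w - 2 * s by rewrite size_drop.
have hw2 : size w2 = size w - 3 * s by rewrite size_drop hw1; lia.
have hw3 : size w3 = size w - 4 * s by rewrite size_drop hw2; lia.
have hrest : size rest = size w - 5 * s by rewrite size_drop hw3; lia.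
have sD0 : size D0 = 2 * s by rewrite size_take_min; apply/minn_idPl; lia.
have sc : size c = s by rewrite size_take_min; apply/minn_idPl; lia.
have sD1 : size D1 = s by rewrite size_take_min; apply/minn_idPl; lia.
have sD2 : size D2 = s by rewrite size_take_min; apply/minn_idPl; lia.
have srest : 2 * s * r <= size rest by lia.
clearbody D0 c D1 D2 rest; clear w1 w2 w3 hw1 hw2 hw3 hrest.
have y0 : 0 < y by lia.
have s0 : 0 < s by rewrite muln_gt0 y0; lia.
pose D := D1 ++ D2.
have sD : size D = 2 * s by rewrite size_cat sD1 sD2 mul2n addnn.
move: (uw); rewrite ew cat_uniq => /and3P[uD0 dD0 ucr].
move: (ucr); rewrite cat_uniq => /and3P[uc dc ur].
have uD : uniq D by move: ur; rewrite catA cat_uniq => /and3P[].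
have cD0 : #|[set z in D0]| = 2 * s by rewrite cardsE (card_uniqP uD0).
have cD : #|[set z in D]| = 2 * s by rewrite cardsE (card_uniqP uD).
have cc : #|[set z in c]| = s by rewrite cardsE (card_uniqP uc).
have [||||||S [bS iS hC0 hC]] := @drc2 4 4 _ _ (fun x z => T z x) T [set z in c]
    [set z in D0] [set z in D] isT isT.
- by lia.
- by rewrite cD0 muln_gt0.
- by rewrite cD muln_gt0.
- by rewrite cc leq_pmulr //; lia.
- move=> x; rewrite inE => xc; rewrite card_count // cD0 -sD0.
  by apply: (median_in (w0 := [::]) (c := c) (w3 := D1 ++ D2 ++ rest)); rewrite -?ew ?sD0 ?sc.
- move=> x; rewrite inE => xc; rewrite card_count // cD -sD.
  by apply: (median_out (w0 := D0) (c := c) (w3 := rest)); rewrite -?catA -?ew ?sD ?sc.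
set C0 := [set z in [set z in D0] | _] in hC0.
set C := [set z in [set z in D] | _] in hC.
have hCa0 : 2 * a <= #|C0| by rewrite -(leq_pmul2l y0) mulnCA -/s -cD0.
have hCa : 2 * a <= #|C| by rewrite -(leq_pmul2l y0) mulnCA -/s -cD.
have sC : {subset C <= D1 ++ D2} by move=> z; rewrite !inE => /andP[].
have SC : {in C, forall z, all (T^~ z) S} by move=> z; rewrite !inE => /andP[].
have irr : irreflexive T by case: hT.
have [q [Ap [h1 h2 h3 h4 [h5 h6]]]] : exists q Ap, [/\ size q = r, all block q,
    uniq (flatten q ++ Ap), {subset flatten q ++ Ap <= D1 ++ D2 ++ rest} & a <= size Ap /\
    (path (precedes T k) S q /\ allrel T (last S q) Ap)].
  have [hC1|hC2] := split_half sC hCa.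
    have [||||||q [Ap [h1 h2 h3 h4 [h5 h6]]]] := @forward_chain a r (D0 ++ c) D1 (D2 ++ rest)
      [set z in C | z \in D1] hya.
    - by rewrite -!catA -ew.
    - by rewrite -!catA -ew.
    - exact: sD1.
    - by rewrite size_cat (leq_trans srest) // leq_addl.
    - by move=> z; rewrite inE => /andP[].
    - exact: hC1.
    exists q, Ap; split=> //; last by split=> //; apply: h6 => z; rewrite inE => /andP[/SC].
    by move=> z /h4; rewrite !inE mem_cat => /orP[/andP[_ ->]//|->]; rewrite orbT.
  have [||||||q [Ap [h1 h2 h3 h4 [h5 h6]]]] := @forward_chain a r (D0 ++ c ++ D1) D2 rest
    [set z in C | z \in D2] hya.
  - by rewrite -!catA -ew.
  - by rewrite -!catA -ew.
  - exact: sD2.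
  - exact: srest.
  - by move=> z; rewrite inE => /andP[].
  - exact: hC2.
  exists q, Ap; split=> //; last by split=> //; apply: h6 => z; rewrite inE => /andP[/SC].
  by move=> z /h4; rewrite !inE !mem_cat => /orP[/andP[_ ->]|->]; rewrite ?orbT.
case: h6 => pq tAp.
pose Am := take a (enum C0); pose Ap' := take a Ap.
have AmC x : x \in Am -> x \in C0 by move/mem_take; rewrite mem_enum.
have ApAp x : x \in Ap' -> x \in Ap by move/mem_take.
have pS : pairwise T S by case/andP: bS.
have ic x : x \in S -> x \in c by move/iS; rewrite inE.
have uqAp : uniq (flatten q ++ Ap').
  by apply: subseq_uniq h3; rewrite cat_subseq // take_subseq.
have sq x : x \in flatten q ++ Ap' -> x \in D1 ++ D2 ++ rest.
  move=> xq; apply: (h4 x); move: xq; rewrite !mem_cat.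
  by case/orP=> [->//|/ApAp->]; rewrite orbT.
have uSq : uniq (S ++ flatten q ++ Ap').
  rewrite cat_uniq uqAp (pairwise_uniq irr pS) andbT /=.
  by apply/hasPn => x /sq xr; apply/negP => /ic xc; move/hasPn: dc => /(_ _ xr); rewrite /= xc.
have uall : uniq (Am ++ S ++ flatten q ++ Ap').
  rewrite cat_uniq take_uniq ?enum_uniq // uSq andbT /=.
  apply/hasPn => x xS; apply/negP => /AmC; rewrite !inE => /andP[xD0 _].
  move/hasPn: dD0 => /(_ x); rewrite /= xD0 => h; apply/negPn/h: isT.
  by move: xS; rewrite mem_cat [x \in c ++ _]mem_cat => /orP[/ic->//|/sq->]; rewrite orbT.
exists (Am, S, q, Ap'); split; last by rewrite /= h1.
- split.
  + rewrite /chain /= bS h2 pq /=.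
    by move: uSq; rewrite catA cat_uniq => /and3P[].
  + by apply/allrelP => x z /AmC; rewrite inE => /andP[_ /allP]; apply.
  + by apply/allrelP => x z xl /ApAp zA; apply: (allrelP tAp).
  + split; rewrite size_take_min; apply/minn_idPl => //.
    by rewrite -cardE (leq_trans _ hCa0) // leq_pmull.
  + by rewrite /oc_vertices /= -catA.
- move=> x; rewrite -wW ew /oc_vertices /= -catA mem_cat => /orP[/AmC|].
    by rewrite !inE mem_cat => /andP[->].
  by rewrite mem_cat [x \in D0 ++ _]mem_cat [x \in c ++ _]mem_cat => /orP[/ic->|/sq->]; rewrite ?orbT.
Qed.

Lemma open_chain_size a p : open_chain a p ->
  size (oc_vertices p) = 2 * a + size (oc_blocks p) * k.
Proof.
case: p => [[[Am R] q] Ap] [cq _ _ [hm hp] _].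
rewrite /oc_vertices size_cat [size (flatten _ ++ _)]size_cat (size_flatten_chain cq) hm hp /oc_blocks; lia.
Qed.

(** Chains are removed until the rest is too small for another one. Each has more than [r] blocks
    and wastes only its [2 * a] reserved vertices, so a large [r] keeps the waste negligible. *)
Lemma cover a r m (W : {set V}) : y <= a -> #|W| <= m -> exists ps,
  [/\ {in ps, forall p, open_chain a p}, uniq (flatten (map (@oc_vertices V) ps)),
      {subset flatten (map (@oc_vertices V) ps) <= W}, size ps * r <= #|W| &
      #|[set x in W | x \notin flatten (flatten (map (@oc_blocks V) ps))]| <=
        (5 + 2 * r) * (y * a) + size ps * (2 * a)].
Proof.
move=> hya; elim: m W => [|m IH] W hW.
  exists [::]; split=> //=; rewrite (leq_trans (n := #|W|)) //; last by lia.
  by apply/subset_leq_card/subsetP => x; rewrite inE => /andP[].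
have [hlt|hge] := ltnP #|W| ((5 + 2 * r) * (y * a)).
  exists [::]; split=> //=; rewrite addn0 (leq_trans _ (ltnW hlt)) //.
  by apply/subset_leq_card/subsetP => x; rewrite inE => /andP[].
have [p [op sp bp]] := open_chain_exists hya hge.
have sup := open_chain_size op.
have up : uniq (oc_vertices p) by case: p op {sp bp sup} => [[[Am R] q] Ap] [].
pose P := [set x in oc_vertices p].
have cP : #|P| = 2 * a + r.+1 * k by rewrite cardsE (card_uniqP up) sup bp.
have sPW : P \subset W by apply/subsetP => x; rewrite inE => /sp.
have hWP : #|W :\: P| + #|P| = #|W| by rewrite cardsDS // subnK // subset_leq_card.
have rk : r + 1 <= r.+1 * k by rewrite addn1 leq_pmulr; lia.
have [|ps [h1 h2 h3 h4 h5]] := IH (W :\: P); first by lia.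
exists (p :: ps); split.
- by move=> p'; rewrite inE => /predU1P[->//|/h1].
- rewrite /= cat_uniq up h2 andbT /=; apply/hasPn => x /h3.
  by rewrite !inE => /andP[].
- move=> x; rewrite /= mem_cat => /orP[/sp//|/h3].
  by rewrite inE => /andP[].
- rewrite /= mulSn -hWP addnC leq_add // cP (leq_trans _ (leq_addl _ _)) //.
  by apply: leq_trans rk; rewrite leq_addr.
- rewrite [size (p :: ps)]/= mulSn [leqRHS]addnCA [leqRHS]addnC.
  apply: leq_trans (leq_add h5 (leqnn (2 * a))).
  have [Am [R [q [Ap ep]]]] : exists Am R q Ap, p = (Am, R, q, Ap).
    by case: (p) => [[[Am R] q] Ap]; exists Am, R, q, Ap.
  have cA : #|[set x in Am] :|: [set x in Ap]| <= 2 * a.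
    move: op; rewrite ep => -[_ _ _ [<- hp] _].
    rewrite (leq_trans (leq_card_setU _ _)) // mul2n -addnn -{2}hp.
    by rewrite leq_add // cardsE card_size.
  rewrite (leq_trans _ (leq_add (leqnn _) cA)) // (leq_trans _ (leq_card_setU _ _)) //.
  apply/subset_leq_card/subsetP => x.
  have eF : flatten (flatten (map (@oc_blocks V) (p :: ps))) =
      flatten (R :: q) ++ flatten (flatten (map (@oc_blocks V) ps)).
    by rewrite ep; apply: (flatten_cat (R :: q)).
  rewrite eF /P !inE ep (mem_cat x Am) (mem_cat x (flatten (R :: q)) Ap).
  rewrite mem_cat negb_or => /and3P[-> /negbTE-> ->].
  by case: (x \in Am); case: (x \in Ap).
Qed.

(** * Joining open chains by connectors *)

Definition connectsb (q : seq (seq V)) (p : V * V) :=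
  if q is R :: l then all (T p.1) R && all (T^~ p.2) (last R l) else false.

Lemma connectsP q p : connects q p -> connectsb q p.
Proof. by case=> S [l [-> h1 h2]]; rewrite /= h1. Qed.

(** There are [y ^ 10] pairs and at most [y ^ 4] connectors, so one connector serves [y ^ 6] pairs.
    Each coordinate has [y ^ 5] choices, so at least [y] vertices are served on either side, enough
    for a transitive block by Ramsey. *)
Lemma bridge cs (Ap Am : seq V) : connector_round cs -> uniq Ap -> uniq Am ->
  size Ap = y ^ 5 -> size Am = y ^ 5 -> exists F S l G,
  [/\ S :: l \in cs, block F, block G, {subset F <= Ap} /\ {subset G <= Am} &
      allrel T F S /\ allrel T (last S l) G].
Proof.
move=> [hcs ccs hp] uAp uAm sAp sAm.
pose D := setX [set u in Ap] [set v in Am].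
have cD : #|D| = y ^ 5 * y ^ 5.
  by rewrite cardsX !cardsE (card_uniqP uAp) (card_uniqP uAm) sAp sAm.
have D0 : 0 < #|D| by rewrite cD muln_gt0 !expn_gt0; lia.
have h1 : #|D| <= \sum_(q <- cs) #|[set p in D | connectsb q p]|.
  apply: card_le_sum_cover => p _; have [q qcs /connectsP hq] := hp p.
  by apply/hasP; exists q.
have : has (fun q => #|D| <= y ^ 4 * #|[set p in D | connectsb q p]|) cs.
  apply/negPn/negP => /hasPn hn.
  have : \sum_(q <- cs) (y ^ 4 * #|[set p in D | connectsb q p]|) <= \sum_(q <- cs) #|D|.-1.
    rewrite big_seq [leqRHS]big_seq leq_sum // => q /hn; rewrite -ltnNge; lia.
  rewrite -big_distrr /= big_const_seq count_predT iter_addn_0.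
  have h2 : y ^ 4 * #|D| <= y ^ 4 * \sum_(q <- cs) #|[set p in D | connectsb q p]|.
    by rewrite leq_mul2l h1 orbT.
  have h3 : #|D|.-1 * size cs <= #|D|.-1 * y ^ 4 by rewrite leq_mul2l hcs orbT.
  have h4 : #|D|.-1 * y ^ 4 < y ^ 4 * #|D|.
    by rewrite mulnC ltn_pmul2l ?expn_gt0; lia.
  move=> h5; have := leq_trans h2 (leq_trans h5 h3); lia.
case/hasP => -[|R l] qcs.
  have -> : [set p in D | connectsb [::] p] = set0.
    by apply/setP => p; rewrite !inE andbF.
  by rewrite cards0 muln0 leqNgt D0.
set P := [set p in D | _] => hP.
pose A1 := [set u in Ap | all (T u) R]; pose A2 := [set v in Am | all (T^~ v) (last R l)].
have hPA : #|P| <= #|A1| * #|A2|.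
  rewrite -cardsX; apply/subset_leq_card/subsetP => -[u v]; rewrite !inE /=.
  by move=> /andP[/andP[-> ->] /andP[-> ->]].
have cA1 : #|A1| <= y ^ 5.
  by rewrite -sAp -(card_uniqP uAp) subset_leq_card //; apply/subsetP => x; rewrite inE => /andP[].
have cA2 : #|A2| <= y ^ 5.
  by rewrite -sAm -(card_uniqP uAm) subset_leq_card //; apply/subsetP => x; rewrite inE => /andP[].
have y4 : 0 < y ^ 4 * y ^ 5 by rewrite muln_gt0 !expn_gt0; lia.
have hyA1 : y <= #|A1|.
  rewrite -(leq_pmul2l y4) (_ : _ * y = #|D|); last by rewrite cD (expnS y 4); ring.
  by rewrite (leq_trans hP) // -mulnA leq_mul2l (leq_trans hPA) ?orbT // mulnC leq_mul2r cA2 orbT.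
have hyA2 : y <= #|A2|.
  rewrite -(leq_pmul2l y4) (_ : _ * y = #|D|); last by rewrite cD (expnS y 4); ring.
  by rewrite (leq_trans hP) // -mulnA leq_mul2l (leq_trans hPA) ?orbT // leq_mul2r cA1 orbT.
have [F [sF pF iF]] := ramsey hT (leq_trans h2ky hyA1).
have [G [sG pG iG]] := ramsey hT (leq_trans h2ky hyA2).
exists F, R, l, G; split=> //.
- by rewrite /block sF eqxx.
- by rewrite /block sG eqxx.
- by split=> x; [move/iF|move/iG]; rewrite inE => /andP[].
- split; apply/allrelP => x z.
    by move=> /iF; rewrite inE => /andP[_ /allP]; apply.
  by move=> xl /iG; rewrite inE => /andP[_ /allP]; apply.
Qed.

Lemma uniq_replace (A F x z : seq V) :
  uniq (x ++ A ++ z) -> uniq F -> {subset F <= A} -> uniq (x ++ F ++ z).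
Proof.
rewrite !cat_uniq !has_cat !negb_or => /and3P[-> /andP[d1 ->] /and3P[_ d2 ->]] uF sF.
rewrite uF !andbT /=; apply/andP; split.
  by apply/hasPn => v /sF vA; apply: (hasPn d1).
by apply/hasPn => v vz; apply/negP => /sF vA; move: (hasPn d2 _ vz); rewrite /= vA.
Qed.

Lemma uniq_block S : block S -> uniq S.
Proof. by case/andP => _; apply: pairwise_uniq; case: hT. Qed.

Lemma splice Am R q Ap Am' R' q' Ap' cs :
  open_chain (y ^ 5) (Am, R, q, Ap) -> open_chain (y ^ 5) (Am', R', q', Ap') ->
  connector_round cs ->
  uniq (oc_vertices (Am, R, q, Ap) ++ oc_vertices (Am', R', q', Ap') ++ flatten (flatten cs)) ->
  exists q1, [/\ open_chain (y ^ 5) (Am, R, q ++ q1, Ap'),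
    {subset flatten (R' :: q') <= flatten q1} &
    {subset flatten q1 <= Ap ++ oc_vertices (Am', R', q', Ap') ++ flatten (flatten cs)}].
Proof.
move=> [cq tA tP [sAm sAp] u1] [cq' tA' tP' [sAm' sAp'] u2] rcs.
rewrite /oc_vertices; set f := flatten (R :: q); set f' := flatten (R' :: q').
move=> U.
have uAp : uniq Ap by move: u1; rewrite /oc_vertices !cat_uniq => /and3P[_ _ /and3P[]].
have uAm' : uniq Am' by move: u2; rewrite /oc_vertices cat_uniq => /and3P[].
have [F [S [l [G [lcs bF bG [iF iG] [tF tG]]]]]] := bridge rcs uAp uAm' sAp sAm'.
have [_ ccs _] := rcs; have cl := ccs _ lcs.
have scs : {subset flatten (S :: l) <= flatten (flatten cs)}.
  move=> x /flattenP[B Bl xB]; apply/flattenP; exists B => //.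
  by apply/flattenP; exists (S :: l).
exists (F :: (S :: l) ++ G :: R' :: q').
have ef1 : flatten (F :: (S :: l) ++ G :: R' :: q') = F ++ flatten (S :: l) ++ G ++ f'.
  exact: (congr1 (cat F) (flatten_cat (S :: l) (G :: R' :: q'))).
have ef : flatten (R :: q ++ F :: (S :: l) ++ G :: R' :: q') = f ++ F ++ flatten (S :: l) ++ G ++ f'.
  by rewrite -ef1 -cat_cons flatten_cat.
have uV : uniq (Am ++ (f ++ F ++ flatten (S :: l) ++ G ++ f') ++ Ap').
  have U1 : uniq ((Am ++ f) ++ Ap ++ (flatten (flatten cs) ++ Am' ++ f' ++ Ap')).
    rewrite -(perm_uniq (s1 := (Am ++ f ++ Ap) ++ (Am' ++ f' ++ Ap') ++ flatten (flatten cs))) //.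
    by apply/permP => x; rewrite !count_cat; clear; lia.
  have := uniq_replace U1 (uniq_block bF) iF; rewrite catA => U2.
  have /and3P[_ _ ul] := cl.
  have := uniq_replace U2 ul scs; rewrite catA => U3.
  by have := uniq_replace U3 (uniq_block bG) iG; rewrite -!catA.
split.
- split=> //.
  + case/and3P: cq => a1 s1 _; case/and3P: cq' => a2 s2 _; case/and3P: cl => a3 s3 _.
    rewrite /chain ef; apply/and3P; split.
    * by move: a1 a2 a3; rewrite -cat_cons all_cat /= all_cat /= bF bG => -> /andP[-> ->] /andP[-> ->].
    * rewrite /= cat_path /= cat_path /=; move: s1 s2 s3 => /= -> -> ->.
      rewrite (allrel_precedes k tF) andbT /=; apply/and3P; split.
      - by apply/allrel_precedes/allrelP => x z xR /iF; apply: (allrelP tP).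
      - exact: allrel_precedes.
      - by apply/allrel_precedes/allrelP => x z /iG xA; apply: (allrelP tA').
    * by move: uV; rewrite !cat_uniq => /and3P[_ _ /and3P[->]].
  + by rewrite last_cat /= last_cat.
  + by rewrite /oc_vertices ef.
- by move=> x xf; rewrite ef1; do 3!(rewrite mem_cat; apply/orP; right).
- move=> x; rewrite ef1 mem_cat => /orP[/iF h|]; first by rewrite mem_cat h.
  rewrite mem_cat => h1; rewrite mem_cat; apply/orP; right; rewrite mem_cat.
  case/orP: h1 => [/scs->|]; rewrite ?orbT //.
  rewrite mem_cat => /orP[/iG h|h]; rewrite mem_cat ?h //.
  by rewrite (mem_cat x f') h orbT.
Qed.

Lemma splice_all Am R q Ap ps css :
  open_chain (y ^ 5) (Am, R, q, Ap) -> {in ps, forall p, open_chain (y ^ 5) p} ->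
  size css = size ps -> {in css, forall cs, connector_round cs} ->
  uniq (oc_vertices (Am, R, q, Ap) ++ flatten (map (@oc_vertices V) ps)
    ++ flatten (flatten (flatten css))) ->
  exists q1 Ap', [/\ open_chain (y ^ 5) (Am, R, q ++ q1, Ap'),
    {subset flatten (flatten (map (@oc_blocks V) ps)) <= flatten q1} &
    {subset flatten q1 ++ Ap' <= Ap ++ flatten (map (@oc_vertices V) ps)
      ++ flatten (flatten (flatten css))}].
Proof.
elim: ps css q Ap => [|p' ps IH] css q Ap op ops.
  case: css => // _ _ _; exists [::], Ap; rewrite cats0; split=> // x.
  by rewrite /= mem_cat => ->.
case: css => // cs css [scss] hcss U.
have := ops p' (mem_head _ _); case e : p' => [[[Am' R'] q'] Ap'] op'.
have eF : flatten (flatten (flatten (cs :: css))) =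
    flatten (flatten cs) ++ flatten (flatten (flatten css)).
  by rewrite /= !flatten_cat.
have eV : flatten (map (@oc_vertices V) (p' :: ps)) = oc_vertices p' ++ flatten (map (@oc_vertices V) ps).
  by [].
have eB : flatten (flatten (map (@oc_blocks V) (p' :: ps))) =
    flatten (oc_blocks p') ++ flatten (flatten (map (@oc_blocks V) ps)).
  by rewrite [LHS]/= flatten_cat.
rewrite -e; rewrite eF eV eB in U *.
move: U; set v := oc_vertices (Am, R, q, Ap); set vs := flatten (map _ ps).
set fc := flatten (flatten cs); set fcs := flatten (flatten (flatten css)) => U.
have U' : uniq ((v ++ oc_vertices p' ++ fc) ++ (vs ++ fcs)).
  rewrite -(perm_uniq (s1 := v ++ (oc_vertices p' ++ vs) ++ fc ++ fcs)) //.
  by apply/permP => x; rewrite !count_cat; clear; lia.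
move: (U'); rewrite cat_uniq e => /and3P[U1 U2 U3].
have [q1 [h1 h2 h3]] := splice op op' (hcss cs (mem_head _ _)) U1.
have sub x : x \in oc_vertices (Am, R, q ++ q1, Ap') -> x \in v ++ oc_vertices p' ++ fc.
  rewrite e mem_cat => /orP[xA|].
    by rewrite mem_cat /v mem_cat xA.
  rewrite -cat_cons flatten_cat mem_cat [x \in _ ++ flatten q1]mem_cat.
  case/orP => [/orP[xf|/h3]|hx].
  - by rewrite mem_cat /v mem_cat [x \in _ ++ Ap]mem_cat xf orbT.
  - rewrite mem_cat => /orP[xA|h]; rewrite mem_cat ?h ?orbT //.
    by rewrite /v mem_cat [x \in _ ++ Ap]mem_cat xA !orbT.
  - have pA : x \in oc_vertices (Am', R', q', Ap').
      by rewrite /oc_vertices mem_cat [x \in _ ++ Ap']mem_cat hx !orbT.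
    by rewrite mem_cat [x \in _ ++ fc]mem_cat pA orbT.
have [||||q2 [Ap2 [g1 g2 g3]]] := IH css (q ++ q1) Ap' h1.
- by move=> p pp; apply: ops; rewrite inE pp orbT.
- by [].
- by move=> c cc; apply: hcss; rewrite inE cc orbT.
- rewrite cat_uniq U3 andbT; case: h1 => _ _ _ _ -> /=.
  by apply/hasPn => x /(hasPn U2); apply: contra => /sub; rewrite e.
exists (q1 ++ q2), Ap2; rewrite catA; split=> //.
  move=> x; rewrite flatten_cat mem_cat [x \in _ ++ flatten q2]mem_cat.
  by case/orP => [/h2->|/g2->]; rewrite ?orbT.
have pA x : x \in Ap' -> x \in oc_vertices (Am', R', q', Ap').
  by move=> hx; rewrite /oc_vertices mem_cat [x \in _ ++ Ap']mem_cat hx !orbT.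
move: (oc_vertices (Am', R', q', Ap')) h3 pA => u' h3 pA x.
rewrite flatten_cat -catA mem_cat => /orP[/h3|/g3].
  by rewrite !mem_cat => /or3P[->|->|->]; rewrite ?orbT.
by rewrite !mem_cat => /or3P[/pA->|->|->]; rewrite ?orbT.
Qed.

Lemma close_cycle Am R q Ap cs :
  open_chain (y ^ 5) (Am, R, q, Ap) -> connector_round cs ->
  uniq (oc_vertices (Am, R, q, Ap) ++ flatten (flatten cs)) ->
  exists q1, [/\ cycle (precedes T k) (R :: q ++ q1), all block (R :: q ++ q1) &
    uniq (flatten (R :: q ++ q1))].
Proof.
move=> [cq tA tP [sAm sAp] u1] rcs; rewrite /oc_vertices; set f := flatten (R :: q) => U.
have uAp : uniq Ap by move: u1; rewrite /oc_vertices !cat_uniq => /and3P[_ _ /and3P[]].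
have uAm : uniq Am by move: u1; rewrite /oc_vertices cat_uniq => /and3P[].
have [F [S [l [G [lcs bF bG [iF iG] [tF tG]]]]]] := bridge rcs uAp uAm sAp sAm.
have [_ ccs _] := rcs; have cl := ccs _ lcs.
have scs : {subset flatten (S :: l) <= flatten (flatten cs)}.
  move=> x /flattenP[B Bl xB]; apply/flattenP; exists B => //.
  by apply/flattenP; exists (S :: l).
exists (F :: (S :: l) ++ [:: G]).
have ef : flatten (R :: q ++ F :: (S :: l) ++ [:: G]) = f ++ F ++ flatten (S :: l) ++ G.
  rewrite -cat_cons flatten_cat; apply: (congr1 (cat f)); apply: (congr1 (cat F)).
  by rewrite -[in RHS](cats0 G); apply: (flatten_cat (S :: l) [:: G]).
case/and3P: cq => a1 s1 _; case/and3P: (cl) => a3 s3 _; split.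
- rewrite /= rcons_path cat_path /= cat_path /= !last_cat /= last_cat /=.
  move: s1 s3 => /= -> ->; rewrite (allrel_precedes k tF) (allrel_precedes k tG) /= !andbT.
  apply/andP; split.
    by apply/allrel_precedes/allrelP => x z xR /iF; apply: (allrelP tP).
  by apply/allrel_precedes/allrelP => x z /iG xA; apply: (allrelP tA).
- by move: a1 a3; rewrite -cat_cons all_cat /= all_cat /= bF bG => -> /andP[-> ->].
- rewrite ef.
  have U1 : uniq (f ++ Ap ++ (flatten (flatten cs) ++ Am ++ [::])).
    rewrite -(perm_uniq (s1 := (Am ++ f ++ Ap) ++ flatten (flatten cs))) //.
    by apply/permP => x; rewrite cats0 !count_cat; clear; lia.
  have := uniq_replace U1 (uniq_block bF) iF; rewrite catA => U2.
  have /and3P[_ _ ul] := cl.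
  have := uniq_replace U2 ul scs; rewrite catA => U3.
  by have := uniq_replace U3 (uniq_block bG) iG; rewrite cats0 -!catA.
Qed.

(** * Assembling the Hamilton cycle *)

Lemma small_power c j : c <= 1000 -> j < 70 -> c * y ^ j <= n.
Proof.
move=> hc hj; rewrite (leq_trans _ (le_n hj)) // expnS leq_mul2r.
by rewrite (leq_trans hc yE) orbT.
Qed.

Lemma small_quotient c X i j : c <= 1000 -> X * y ^ i <= n -> j < i -> c * (X * y ^ j) <= n.
Proof.
move=> hc hX hj; rewrite (leq_trans _ hX) // mulnCA leq_mul2l; apply/orP; right.
rewrite -(subnK hj) expnD expnS mulnA leq_mul //.
by rewrite mulnC -[c]muln1 leq_mul ?expn_gt0 // ?(leq_trans hc) //; lia.
Qed.

Lemma pick_seq (A : {set V}) a : a <= #|A| -> exists s : seq V,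
  [/\ uniq s, size s = a & {subset s <= A}].
Proof.
move=> ha; exists (take a (enum A)); split.
- by rewrite take_uniq // enum_uniq.
- by rewrite size_take_min; apply/minn_idPl; rewrite -cardE.
- by move=> x /mem_take; rewrite mem_enum.
Qed.

(** [M] counts absorbing segments, and [N] bounds the number of covering chains. The segments use
    about [n / y ^ 10] vertices at most, while connectors and wasted reserves amount to about
    [n / y ^ 23], well below [M]. *)
Let M := n %/ y ^ 18.
Let N := n %/ y ^ 30.
Let hM : M * y ^ 18 <= n. Proof. exact: leq_trunc_div. Qed.
Let hN : N * y ^ 30 <= n. Proof. exact: leq_trunc_div. Qed.

Let absorbing_size_le a : a <= 9 -> 16 * (y ^ a * (y ^ 2 + M * y ^ 8)) <= n.
Proof.
move=> ha; rewrite (leq_trans (n := 16 * (y ^ 11 + M * y ^ 17))) //.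
  rewrite leq_mul2l mulnDr mulnCA -!expnD leq_add ?orbT // ?leq_exp2l //; try lia.
  by rewrite leq_mul2l leq_exp2l ?orbT //; lia.
have h1 : 32 * y ^ 11 <= n by apply: small_power.
have h2 : 32 * (M * y ^ 17) <= n by apply: small_quotient hM _.
by rewrite mulnDr; lia.
Qed.

Lemma absorbing_chain : exists S0 q0 qs Am Ap,
  [/\ size qs = M, open_chain (y ^ 5) (Am, S0, q0 ++ flatten qs, Ap),
    size (flatten (S0 :: q0 ++ flatten qs)) <= y ^ 2 + M * y ^ 8 &
    {in qs, forall e v, v \notin flatten (S0 :: q0 ++ flatten qs) -> serves e v}].
Proof.
have [|S0 [q0 [qs [h1 h2 h3 h4 [h5 h6]]]]] := @gadget_rounds M.
  by have := absorbing_size_le (a := 7) isT; apply: leq_trans; rewrite leq_pmull.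
set q := q0 ++ flatten qs in h2 h4 h5 h6; set Q := flatten (S0 :: q) in h5 h6.
have big (A : {set V}) : n <= y * #|A| -> 2 * y ^ 5 <= #|A :\: [set x in Q]|.
  move=> hA; have cQ : #|[set x in Q]| <= y ^ 2 + M * y ^ 8.
    by rewrite cardsE (leq_trans (card_size _)).
  have hQ : 16 * (y * #|[set x in Q]|) <= n.
    rewrite (leq_trans _ (absorbing_size_le (a := 1) isT)) // expn1 !leq_mul2l cQ !orbT //.
  have h6' : 4 * y ^ 6 <= n by apply: small_power.
  have y0 : 0 < y by lia.
  rewrite -(leq_pmul2l y0) mulnCA -expnS.
  have e : y * #|A| = y * #|A :&: [set x in Q]| + y * #|A :\: [set x in Q]|.
    by rewrite -mulnDr cardsID.
  have hI : y * #|A :&: [set x in Q]| <= y * #|[set x in Q]|.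
    by rewrite leq_mul2l subset_leq_card ?orbT // subsetIr.
  move: h6' hQ hA e hI; move: (y * _) (y * _) (y * _) (y * _) (y ^ 6) => u v w z t.
  by clear; lia.
have [|Am [uAm sAm iAm]] := @pick_seq (cin S0 :\: [set x in Q]) (y ^ 5).
  by rewrite (leq_trans _ (big _ h3)) // leq_pmull.
have [|Ap [uAp sAp iAp]] := @pick_seq ((cout (last S0 q) :\: [set x in Q]) :\: [set x in Am]) (y ^ 5).
  have := big _ h4; set A := _ :\: _ => hA.
  have := cardsID [set x in Am] A; have := subset_leq_card (subsetIr A [set x in Am]).
  by rewrite [#|[set x in Am]|]cardsE (card_uniqP uAm) sAm; lia.
exists S0, q0, qs, Am, Ap; split=> //; split=> //.
- by apply/allrelP => x z /iAm; rewrite !inE => /andP[_ /allP]; apply.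
- by apply/allrelP => x z xl /iAp; rewrite !inE => /and3P[_ _ /allP]; apply.
- rewrite /oc_vertices -/q -/Q cat_uniq uAm [uniq (Q ++ _)]cat_uniq uAp; case/and3P: h2 => _ _ ->.
  rewrite has_cat !negb_or !andbT /= -?andbA; apply/and3P; split.
  + by apply/hasPn => x xQ; apply/negP => /iAm; rewrite !inE xQ.
  + by apply/hasPn => x /iAp; rewrite !inE => /andP[].
  + by apply/hasPn => x /iAp; rewrite !inE => /and3P[].
Qed.

(** The summands bound the reserves of the absorbing chain, all connectors, and what [cover] leaves
    outside its blocks when it yields [s] chains. *)
Lemma leftover_le s w : s * y ^ 30 <= n ->
  w <= 2 * y ^ 5 + N.+1 * y ^ 7 + ((5 + 2 * y ^ 30) * (y * y ^ 5) + s * (2 * y ^ 5)) -> w <= M.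
Proof.
move=> hs hw; have y18 : 0 < y ^ 18 by rewrite expn_gt0; lia.
rewrite /M leq_divRL // (leq_trans (leq_mul hw (leqnn _))) //.
have p1 : 16 * y ^ 23 <= n by apply: small_power.
have p2 : 16 * y ^ 25 <= n by apply: small_power.
have p3 : 40 * y ^ 24 <= n by apply: small_power.
have p4 : 16 * y ^ 54 <= n by apply: small_power.
have p5 : 16 * (N * y ^ 25) <= n by apply: small_quotient hN _.
have p6 : 16 * (s * y ^ 23) <= n by apply: small_quotient hs _.
rewrite -expnS; set A := y ^ 18.
have e1 : y ^ 5 * A = y ^ 23 by rewrite -expnD.
have e2 : y ^ 7 * A = y ^ 25 by rewrite -expnD.
have e3 : y ^ 6 * A = y ^ 24 by rewrite -expnD.
have e4 : y ^ 30 * (y ^ 6 * A) = y ^ 54 by rewrite -!expnD.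
have key a b c e z : (2 * a + N.+1 * c + ((5 + 2 * e) * b + s * (2 * a))) * z =
    2 * (a * z) + N * (c * z) + c * z + 5 * (b * z) + 2 * (e * (b * z)) + 2 * (s * (a * z)).
  by clear; lia.
rewrite key e4 e1 e2 e3; move: p1 p2 p3 p4 p5 p6.
move: (N * y ^ 25) (s * y ^ 23) => u v; move: (y ^ 23) (y ^ 24) (y ^ 25) (y ^ 54).
by clear; lia.
Qed.

Lemma expander_hamilton : has_hamilton_cycle_power k T.
Proof.
have [S0 [q0 [qs [Am [Ap [sqs op sQ hqs]]]]]] := absorbing_chain.
set q := q0 ++ flatten qs in op sQ hqs; set Q := flatten (S0 :: q) in sQ hqs.
pose v0 := oc_vertices (Am, S0, q, Ap).
have [_ _ _ [sAm sAp] uv0] := op.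
pose U := [set x in v0].
have cU : #|U| <= (y ^ 2 + M * y ^ 8) + 2 * y ^ 5.
  rewrite cardsE (leq_trans (card_size _)) // /v0 /oc_vertices -/Q size_cat [size (Q ++ _)]size_cat.
  by rewrite sAm sAp addnCA leq_add // mul2n addnn.
(* At most [N] rounds splice the covering chains onto the absorbing chain; the extra one closes the
   cycle. *)
have [|css [scss hcss ucss dcss sfcss]] := connector_rounds (M := N.+1) (U := U).
  have p1 : 16 * y ^ 13 <= n by apply: small_power.
  have p2 : 16 * y ^ 15 <= n by apply: small_power.
  have p3 : 16 * (N * y ^ 15) <= n by apply: small_quotient hN _.
  have p4 := absorbing_size_le (a := 8) isT.
  apply: (leq_trans (n := y ^ 8 * ((y ^ 2 + M * y ^ 8) + 2 * y ^ 5 + N.+1 * y ^ 7))).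
    by rewrite leq_mul2l leq_add2r cU orbT.
  have key x a b c m : a * (x + 2 * b + m.+1 * c) = a * x + 2 * (a * b) + m * (a * c) + a * c.
    by clear; lia.
  rewrite key -!expnD; move: p1 p2 p3 p4; move: (N * _) (y ^ 8 * _) => u w.
  by move: (y ^ 13) (y ^ 15); clear; lia.
case: css scss hcss ucss dcss sfcss => // c css [scss] hcss.
set fcss := flatten (flatten (flatten (c :: css))) => ucss dcss sfcss.
pose W := ~: (U :|: [set x in fcss]).
have [||ps [ops ups sps nps lps]] := @cover (y ^ 5) (y ^ 30) n W.
- by rewrite -[leqLHS]expn1 leq_exp2l //; lia.
- exact: cV.
have nps' : size ps * y ^ 30 <= n by apply: leq_trans nps (cV W).
have efc : fcss = flatten (flatten c) ++ flatten (flatten (flatten css)).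
  by rewrite /fcss /= !flatten_cat.
pose css1 := take (size ps) css.
have scss1 : size css1 = size ps.
  by rewrite size_take_min; apply/minn_idPl; rewrite scss /N leq_divRL // expn_gt0; lia.
have sub1 : subseq (flatten (flatten (flatten css1))) (flatten (flatten (flatten css))).
  by rewrite -{1}(cat_take_drop (size ps) css) !flatten_cat prefix_subseq.
set vs := flatten (map (@oc_vertices V) ps) in ups sps.
have uall : uniq (v0 ++ vs ++ flatten (flatten c) ++ flatten (flatten (flatten css1))).
  rewrite cat_uniq uv0 /= has_cat negb_or cat_uniq ups /=.
  have u3 : uniq (flatten (flatten c) ++ flatten (flatten (flatten css1))).
    by apply: subseq_uniq ucss; rewrite efc cat_subseq.
  have s3 x : x \in flatten (flatten c) ++ flatten (flatten (flatten css1)) -> x \in fcss.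
    by rewrite efc !mem_cat => /orP[->//|/(mem_subseq sub1)->]; rewrite orbT.
  rewrite u3 andbT -andbA; apply/and3P; split; apply/hasPn => x.
  - by move/sps; rewrite !inE negb_or => /andP[].
  - by move/s3/dcss; rewrite !inE.
  - by move/s3 => xf; apply/negP => /sps; rewrite !inE xf orbT.
have [||q1 [Ap' [op1 sF s1]]] := splice_all op ops scss1 (css := css1).
- by move=> c' /mem_take cc; apply: hcss; rewrite inE cc orbT.
- have : uniq (flatten (flatten c) ++ (v0 ++ vs ++ flatten (flatten (flatten css1)))).
    rewrite -(perm_uniq (s1 := v0 ++ vs ++ flatten (flatten c) ++ flatten (flatten (flatten css1)))) //.
    by apply/permP => x; rewrite !count_cat; clear; lia.
  by rewrite cat_uniq => /and3P[].
have s1' x : x \in flatten q1 ++ Ap' -> x \in v0 ++ vs ++ flatten (flatten (flatten css1)).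
  move/s1; rewrite mem_cat => /orP[xA|h]; rewrite mem_cat ?h ?orbT //.
  by rewrite /v0 /oc_vertices mem_cat [x \in _ ++ Ap]mem_cat xA !orbT.
have sub2 : {subset oc_vertices (Am, S0, q ++ q1, Ap') <=
    v0 ++ vs ++ flatten (flatten (flatten css1))}.
  move=> x; rewrite /oc_vertices mem_cat => /orP[xA|].
    by rewrite mem_cat /v0 /oc_vertices mem_cat xA.
  rewrite -cat_cons flatten_cat -/Q -catA mem_cat => /orP[xQ|/s1'//].
  by rewrite mem_cat /v0 /oc_vertices mem_cat [x \in _ ++ Ap]mem_cat xQ orbT.
have [|q2 [cyc bq uq]] := close_cycle op1 (hcss c (mem_head _ _)).
  rewrite cat_uniq; case: (op1) => _ _ _ _ ->.
  have : uniq ((v0 ++ vs ++ flatten (flatten (flatten css1))) ++ flatten (flatten c)).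
    rewrite -(perm_uniq (s1 := v0 ++ vs ++ flatten (flatten c) ++ flatten (flatten (flatten css1)))) //.
    by apply/permP => x; rewrite !count_cat; clear; lia.
  rewrite cat_uniq => /and3P[_ dis ->]; rewrite andbT.
  by apply/hasPn => x /(hasPn dis); apply: contra; apply: sub2.
have ebs : S0 :: (q ++ q1) ++ q2 = (S0 :: q0) ++ flatten qs ++ (q1 ++ q2).
  by rewrite /q -!catA.
have fbs : flatten (S0 :: (q ++ q1) ++ q2) = Q ++ flatten q1 ++ flatten q2.
  by rewrite -catA -cat_cons flatten_cat flatten_cat.
pose ls := [seq v <- enum V | v \notin flatten (S0 :: (q ++ q1) ++ q2)].
have lsP v : (v \in ls) = (v \notin flatten (S0 :: (q ++ q1) ++ q2)).
  by rewrite mem_filter mem_enum andbT.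
have uls : uniq ls by rewrite filter_uniq // enum_uniq.
have sls : size ls <= size qs.
  rewrite sqs; apply: leftover_le nps' _.
  have -> : size ls = #|[set v in ls]| by rewrite cardsE (card_uniqP uls).
  set F := flatten (flatten _) in lps sF.
  pose X := [set x in Am] :|: [set x in Ap]; pose Y := [set x in fcss].
  (* The last set also contains the reserves of the covering chains, which are counted in [lps]. *)
  apply: (leq_trans (n := #|X :|: (Y :|: [set x in W | x \notin F])|)).
    apply/subset_leq_card/subsetP => v; rewrite in_set lsP fbs mem_cat negb_or => /andP[vQ].
    rewrite mem_cat negb_or => /andP[vq1 _].
    have vF : v \notin F by apply: contra vq1 => /sF.
    have [vf|vf] := boolP (v \in fcss); first by rewrite !inE vf /= !orbT.
    rewrite !inE (negbTE vf) vF orbF andbT /= /v0 /oc_vertices -/Q.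
    rewrite mem_cat [v \in Q ++ _]mem_cat (negbTE vQ) /=.
    by case: (v \in Am); case: (v \in Ap).
  rewrite (leq_trans (leq_card_setU _ _)) // -addnA leq_add //.
    rewrite (leq_trans (leq_card_setU _ _)) // mul2n -addnn leq_add // cardsE.
      by rewrite (leq_trans (card_size _)) // sAm.
    by rewrite (leq_trans (card_size _)) // sAp.
  rewrite (leq_trans (leq_card_setU _ _)) // leq_add // cardsE.
  by rewrite (leq_trans (card_size _)).
have [||||bs [b1 b2 b3]] := @absorb V T k ls qs (S0 :: q0) (q1 ++ q2).
- by rewrite -ebs.
- by rewrite -ebs; apply: sub_all bq => B; apply: block_long.
- exact: sls.
- move=> e eq v; rewrite lsP fbs mem_cat negb_or => /andP[vQ _]; exact: hqs.
apply: (cycle_blocks_hamilton (ltnW k2) b1 b2).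
  apply: (perm_trans b3); rewrite -ebs; apply: uniq_perm; last first.
  - by move=> x; rewrite mem_cat lsP mem_enum orbN.
  - exact: enum_uniq.
  rewrite cat_uniq uq uls andbT /=.
  by apply/hasPn => x; rewrite lsP.
by rewrite -n_card.
Qed.

End Expander.

(** * Choice of parameters *)

Section Params.
Variables (k d y : nat).
Hypothesis k2 : 2 <= k.
Hypothesis d2 : 2 <= d.
Hypothesis hy : (2 * d) ^ (14 * k) <= y.

Let expn2d a : 4 ^ a <= (2 * d) ^ a.
Proof. by case: a => // a; rewrite leq_exp2r //; lia. Qed.

Lemma le_y a : a <= 14 * k -> (2 * d) ^ a <= y.
Proof. by move=> h; rewrite (leq_trans _ hy) // leq_exp2l //; lia. Qed.

Lemma two_expk_le : 2 ^ k <= y.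
Proof.
rewrite (leq_trans _ (le_y (a := k) _)) //; last by lia.
by rewrite (leq_trans _ (expn2d k)) // leq_exp2r //; lia.
Qed.

Lemma twok_le : 2 * k <= y.
Proof.
rewrite (leq_trans _ (le_y (a := 2 * k) _)) //; last by lia.
by rewrite ltnW // ltn_expl //; lia.
Qed.

Lemma d_le_y : 1000 * (1000 * d) <= y.
Proof.
rewrite (leq_trans _ (le_y (a := 12) _)) //; last by lia.
have h : 1000 <= (2 * d) ^ 5 by apply: leq_trans (expn2d 5); vm_compute.
have h' : d <= (2 * d) ^ 2 by rewrite expnS expn1; nia.
rewrite (_ : 12 = 5 + (5 + 2)); last by [].
by rewrite !expnD; apply: leq_mul h (leq_mul h h').
Qed.

Variables (V : finType) (T : rel V).
Hypothesis hT : is_tournament T.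

Lemma drc_bounded b (Y : finType) (r : V -> Y -> bool) (A : {set V}) (B : {set Y}) :
  0 < b -> b <= 5 * (1000 * d) -> 0 < #|B| -> y <= #|A| ->
  (forall x, x \in A -> #|B| <= b * #|[set z in B | r x z]|) ->
  exists S, [/\ size S = k, pairwise T S, {subset S <= A} &
    #|B| <= y * #|[set z in B | all (r^~ z) S]|].
Proof.
move=> b0 hb B0 hA hdeg.
have hbx : b <= (2 * d) ^ 8.
  have h5 : 1000 <= (2 * d) ^ 5 by apply: leq_trans (expn2d 5); vm_compute.
  have h2 : 5 <= (2 * d) ^ 2 by exact: leq_trans (expn2d 2).
  have h1 : d <= (2 * d) ^ 1 by rewrite expn1; lia.
  rewrite (_ : 8 = 2 + (5 + 1)); last by [].
  by rewrite !expnD; apply: leq_trans hb _; apply: leq_mul h2 (leq_mul h5 h1).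
(* The loss [2 ^ k.+2 * b ^ k.+1] is at most [(2 * d) ^ (9 * k + 8)], and [9 * k + 8 <= 14 * k]
   holds because [2 <= k]. *)
have hm : 2 * (2 ^ k.+1 * b ^ k) * b <= y.
  rewrite (leq_trans _ (le_y (a := k + 8 * k.+1) _)) //; last by lia.
  rewrite expnD (expnM _ 8) mulnA -mulnA -expnSr -expnS leq_mul //; last first.
    by rewrite leq_exp2r.
  rewrite (leq_trans _ (expn2d k)) // (_ : 4 = 2 ^ 2) // -expnM leq_exp2l //; lia.
have [|S [h1 h2 h3 h4]] := dependent_random_choice hT k2 b0 B0 _ hdeg.
  rewrite (leq_trans _ hA) // (leq_trans _ hm) // -mulnA mulnCA -[leqLHS]muln1 leq_mul //.
  by rewrite muln_gt0.
by exists S; split=> //; rewrite (leq_trans h4) // leq_mul2r hm orbT.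
Qed.

End Params.

Lemma degree_fifth d n x : 2 <= d -> 25 * d * n <= 100 * d * x + n -> n <= 5 * x.
Proof.
move=> d2 h; have d0 : 0 < d by lia.
rewrite -(leq_pmul2l d0); have : 2 * n <= d * n by rewrite leq_mul2r d2 orbT.
lia.
Qed.

Lemma root_floor p n : 0 < p -> exists y, y ^ p <= n < y.+1 ^ p.
Proof.
move=> p0; elim: n => [|n [y /andP[h1 h2]]]; first by exists 0; rewrite exp0n // exp1n.
have [h|h] := leqP (y.+1 ^ p) n.+1; last by exists y; rewrite h ltnW // ltnS.
exists y.+1; rewrite h (leq_ltn_trans h2) //.
by rewrite ltn_exp2r.
Qed.

(** For the integer part [y] of the 70th root of [n], the hypothesis on [n] gives the lower bound
    because [14 * 70 <= 1000]. The logarithmic bound is [y.+1 <= 2 ^ c] raised to the 70th power. *)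
Lemma choose_root d k n : 0 < d -> (2 * d) ^ (1000 * k) <= n -> exists y,
  [/\ (2 * d) ^ (14 * k) <= y, forall a, a <= 70 -> y ^ a <= n &
      forall c, y <= c -> n < 2 ^ (72 * c)].
Proof.
move=> d0 hn; have [y /andP[hy1 hy2]] := @root_floor 70 n isT.
have dd : 0 < 2 * d by rewrite muln_gt0.
have hy : (2 * d) ^ (14 * k) <= y.
  have h : ((2 * d) ^ (14 * k)) ^ 70 < y.+1 ^ 70.
    apply: leq_ltn_trans hy2; apply: leq_trans hn; rewrite -expnM leq_pexp2l //.
    by rewrite mulnAC leq_mul2r; apply/orP; right.
  by rewrite ltn_exp2r in h.
have y0 : 0 < y by apply: leq_trans hy; rewrite expn_gt0 dd.
exists y; split=> // [a ha|c hc].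
  by apply: leq_trans hy1; rewrite leq_pexp2l.
apply: (leq_trans hy2); rewrite mulnC expnM; apply: (leq_trans (n := (2 ^ c) ^ 70)).
  by rewrite leq_exp2r //; apply: leq_ltn_trans hc _; apply: ltn_expl.
by rewrite leq_pexp2l // expn_gt0.
Qed.

Lemma hamilton_power_nat (V : finType) (T : rel V) k d :
  is_tournament T -> 2 <= k -> 2 <= d -> (2 * d) ^ (1000 * k) <= #|V| ->
  (forall v, 25 * d * #|V| <= 100 * d * #|[set w | T v w]| + #|V|) ->
  (forall v, 25 * d * #|V| <= 100 * d * #|[set w | T w v]| + #|V|) ->
  (forall X Y : {set V}, balanced_partition X Y -> #|X| * #|Y| <= d * edges_between T X Y) ->
  has_hamilton_cycle_power k T.
Proof.
move=> hT k2 d2 hn hout hin hcut.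
have [y [hy hle hlog]] := choose_root (ltnW d2) hn.
have dy := d_le_y k2 d2 hy.
have hn1 : 1000 * d <= #|V|.
  by rewrite (leq_trans _ (hle 1 isT)) // expn1; lia.
apply: (@expander_hamilton V T k y #|V| (1000 * d)) => //.
- by lia.
- by lia.
- exact: two_expk_le k2 d2 hy.
- exact: twok_le k2 d2 hy.
- by move=> v; apply: degree_fifth d2 (hout v).
- by move=> v; apply: degree_fifth d2 (hin v).
- by move=> X Y; apply: (expansion hT (erefl _) d2 hn1 hout hin hcut).
- by move=> b Y r A B; apply: (drc_bounded k2 d2 hy hT).
Qed.

(** * From the real parameter to an integer one *)

Lemma edges_between_le (V : finType) (T : rel V) (X Y : {set V}) :
  is_tournament T -> edges_between T X Y + edges_between T Y X <= #|X| * #|Y|.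
Proof.
move=> hT; rewrite !edges_between_sum [X in _ + X]sum_card_rel -big_split /= -sum_nat_const.
apply: leq_sum => x _; rewrite -cardsUI [X in _ + X](_ : _ = 0) ?addn0.
  by apply/subset_leq_card/subsetP => z; rewrite !inE -andb_orr => /andP[].
apply/eqP; rewrite cards_eq0; apply/eqP/setP => z; rewrite !inE.
case: (eqVneq z x) => [->|zx]; first by rewrite (tour_irr hT) !andbF.
by rewrite (tour_neg hT zx); case: (T z x); rewrite !andbF.
Qed.

Lemma min_semidegree_le (V : finType) (T : rel V) v :
  min_semidegree T <= minn (outdeg T v) (indeg T v).
Proof.
rewrite /min_semidegree; elim: (index_enum V) (mem_index_enum v) => // u s IH.
rewrite inE big_cons => /predU1P[->|/IH h]; first exact: geq_minl.
by rewrite geq_min h orbT.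
Qed.

Lemma balanced_partition_half (V : finType) : exists2 X : {set V},
  balanced_partition X (~: X) & #|X| = #|V|./2.
Proof.
have [|X [_ _ cX]] := @subset_between V set0 setT (#|V|./2) (sub0set _).
  by rewrite cards0 cardsT; lia.
exists X => //; have cC := cardsC X; split; first by rewrite setUCr.
  by rewrite disjoints_subset setCK.
by move: cC; rewrite cX; move: #|V| #|~: X| => m c; lia.
Qed.

Local Open Scope ring_scope.

Theorem theorem1p5 (R : realType) (k n : nat) (delta : R)
    (hk : (2 <= k)%N) (hdelta : 0 < delta)
    (hn : (3 / delta) ^+ (1000 * k) <= n%:R)
    (V : finType) (T : rel V) (hV : #|V| = n) (hT : is_tournament T)
    (hcut : cut_dense delta T)
    (hdeg : n%:R / 4 - delta * n%:R / 200 <= (min_semidegree T)%:R :> R) :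
  has_hamilton_cycle_power k T.
Proof.
have n0 : (0 < n)%N.
  by rewrite -(ltr0n R) (lt_le_trans _ hn) // exprn_gt0 // divr_gt0.
(* On one vertex every balanced partition has an empty side, so cut density does not bound [delta];
   but the cycle power has no edges then. *)
have [n1|n2] := leqP n 1.
  have e : #|V| = 1%N by rewrite hV; lia.
  have ord_eq (i j : 'I_#|V|) : i = j.
    have hi : (i < 1)%N by rewrite -e ltn_ord.
    have hj : (j < 1)%N by rewrite -e ltn_ord.
    apply: val_inj => /=; move: hi hj.
    by rewrite !ltnS !leqn0 => /eqP-> /eqP->.
  have /card_gt0P[x0 _] : (0 < #|V|)%N by rewrite e.
  exists (fun=> x0); split.
    by apply: inj_card_bij => [i j _|]; rewrite ?card_ord.
  by move=> i j [/eqP nij _]; case: nij.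
(* Both directions of a balanced cut carry at least [delta * |X| * |Y|] edges, and together at most
   [|X| * |Y|]. *)
have hdelta2 : delta <= 1 / 2.
  have [X bX cX] := balanced_partition_half V.
  have bY : balanced_partition (~: X) X.
    by case: bX => h1 h2 h3; split; rewrite 1?setUC 1?disjoint_sym 1?andbC.
  have e1 := hcut _ _ bX; have e2 := hcut _ _ bY.
  have := edges_between_le X (~: X) hT; rewrite -(ler_nat R) natrD natrM => e3.
  have X0 : (0 < #|X|)%N by rewrite cX hV; lia.
  have Y0 : (0 < #|~: X|)%N by have := cardsC X; rewrite cX hV; lia.
  have p0 : 0 < #|X|%:R * #|~: X|%:R :> R by rewrite mulr_gt0 // ltr0n.
  rewrite -(ler_pM2r p0).
  move: e1 e2 e3; move: (#|X|%:R) (#|~: X|%:R) => a b; nra.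
(* Rounding up gives [1 <= d * delta <= 1 + delta]. With [delta <= 1 / 2] this yields
   [2 * d <= 3 / delta], where the 3 of the theorem enters. *)
pose d := (Num.truncn delta^-1).+1.
have i0 : 0 < delta^-1 by rewrite invr_gt0.
have /andP[d1 d2] := truncn_itv (ltW i0).
have dd1 : 1 <= d%:R * delta by rewrite -ler_pdivrMr // div1r ltW.
have dd2 : d%:R * delta <= 1 + delta.
  rewrite /d -natr1 mulrDl mul1r lerD2r -ler_pdivlMr // div1r.
  exact: d1.
have dge2 : (2 <= d)%N.
  rewrite -(ler_nat R); have : 2 * delta <= 1 by lra.
  move=> h; have := le_trans h dd1; rewrite ler_pM2r //.
(* Multiplying the degree condition by [100 * d] turns its slack into [d * delta * n / 2], which is
   at most [n] since [d * delta <= 2]. *)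
have hdn x : (min_semidegree T <= x)%N -> (25 * d * #|V| <= 100 * d * x + #|V|)%N.
  rewrite -(ler_nat R) => hx; rewrite -(ler_nat R) hV.
  have e1 : (25 * d * n)%:R = 25 * (d%:R * n%:R) :> R by rewrite -mulnA !natrM.
  have e2 : (100 * d * x + n)%:R = 100 * (d%:R * x%:R) + n%:R :> R.
    by rewrite -mulnA natrD !natrM.
  rewrite e1 e2 {e1 e2}.
  have h1 := le_trans hdeg hx.
  have n0' : 0 <= n%:R :> R by rewrite ler0n.
  have d0' : 0 <= d%:R :> R by rewrite ler0n.
  have h2 := ler_wpM2l d0' h1.
  have h3 : d%:R * delta * n%:R <= (1 + delta) * n%:R :> R by rewrite ler_wpM2r.
  have h4 : (1 + delta) * n%:R <= 2 * n%:R :> R by rewrite ler_wpM2r //; lra.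
  have h5 : d%:R * (n%:R / 4 - delta * n%:R / 200) =
      d%:R * n%:R / 4 - d%:R * delta * n%:R / 200 :> R by ring.
  rewrite h5 in h2; move: h2 (le_trans h3 h4).
  move: (d%:R * n%:R) (d%:R * x%:R) (d%:R * delta * n%:R) => a b c h6 h7.
  lra.
apply: (@hamilton_power_nat V T k d) => //.
- rewrite hV -(ler_nat R) natrX; apply: le_trans hn.
  apply: lerXn2r; rewrite ?nnegrE ?ler0n ?divr_ge0 ?ler0n ?(ltW hdelta) //.
  rewrite ler_pdivlMr // natrM; move: dd2 hdelta2; lra.
- by move=> v; apply: hdn; rewrite (leq_trans (min_semidegree_le T v)) // geq_minl.
- by move=> v; apply: hdn; rewrite (leq_trans (min_semidegree_le T v)) // geq_minr.
- move=> X Y bXY; rewrite -(ler_nat R) !natrM.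
  have := hcut X Y bXY.
  have d0' : 0 <= d%:R :> R by rewrite ler0n.
  move=> /(ler_wpM2l d0'); apply: le_trans.
  have p0 : 0 <= #|X|%:R * #|Y|%:R :> R by rewrite mulr_ge0 // ler0n.
  rewrite -[leLHS]mul1r -mulrA [delta * _]mulrC mulrA mulrC.
  nra.
Qed.
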